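(* Let $G$ be a transitive graph. If the cycle space of $G$ is a finitely generated $\mathrm{Aut}(G)$-module, then the cut space of $G$ is a finitely generated $\mathrm{Aut}(G)$-module.
   Context: Graphs may be infinite and need not be locally finite. A graph $G$ is transitive if its automorphism group $\mathrm{Aut}(G)$ acts transitively on the vertex set $V(G)$. Cycle space: cycles are finite cycles; the sum (over $\mathbb F_2$) of finitely many cycles $(C_i)_{i\in I}$ is the subgraph induced by those edges that occur in an odd number of the $C_i$. The set of all sums of finitely many cycles in $G$ is a vector space over $\mathbb F_2$, the cycle space of $G$. Cut space: let $\mathcal B(G)$ be the set of all ordered bipartitions $(A,B)$ of $V(G)$ (that is, $A\cap B=\emptyset$ and $A\cup B=V(G)$; $A$ or $B$ may be empty) such that the set $E(A,B)$ of all edges of $G$ between $A$ and $B$ is finite. The cut space of $G$ is the set of all edge sets $E(A,B)$ with $(A,B)\in\mathcal B(G)$, a vector space over $\mathbb F_2$ with symmetric difference of edge sets as addition. $\mathrm{Aut}(G)$ acts linearly on both spaces in the canonical way, making them $\mathrm{Aut}(G)$-modules. Such an $\mathrm{Aut}(G)$-module is finitely generated if there are finitely many elements that, together with all their images under $\mathrm{Aut}(G)$, generate it as a vector space over $\mathbb F_2$. *)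

(* Defs.v *)
From HB Require Import structures.
From mathcomp Require Import all_boot.
From mathcomp Require Import boolp classical_sets functions cardinality.

Set Implicit Arguments.
Unset Strict Implicit.
Unset Printing Implicit Defensive.

Local Open Scope classical_set_scope.

(* Simple graphs, with no finiteness or connectedness assumption. *)
Record graph := Graph {
  vertex :> choiceType;
  adj : rel vertex;
  adj_sym : symmetric adj;
  adj_irrefl : irreflexive adj }.
Arguments adj {g}.

(* As graphs are simple, an edge is the set of its two ends; subgraphs without
   isolated vertices are identified with their edge sets. *)
Definition edge (G : graph) := set G.
Definition edgeset (G : graph) := set (edge G).

Definition edges (G : graph) : edgeset G :=
  [set e | exists x y, adj x y /\ e = [set x; y]].

Definition Aut (G : graph) : set (G -> G) :=
  [set f | bijective f /\ forall x y, adj (f x) (f y) = adj x y].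

Definition transitive_graph (G : graph) : Prop :=
  forall x y : G, exists2 f, Aut f & f x = y.

Definition act (G : graph) (f : G -> G) (F : edgeset G) : edgeset G :=
  [set f @` e | e in F].

(* Edge sets form a vector space over F_2 under symmetric difference, in which
   a linear combination is a finite sum. *)
Definition edge_sum (G : graph) (s : seq (edgeset G)) : edgeset G :=
  \big[setY/set0]_(F <- s) F.

Definition span (G : graph) (S : set (edgeset G)) : set (edgeset G) :=
  [set edge_sum s | s in [set s | [set` s] `<=` S]].

Definition is_cycle (G : graph) (c : seq G) : Prop :=
  [/\ uniq c, 2 < size c & cycle adj c].

Definition cycle_edges (G : graph) (c : seq G) : edgeset G :=
  [set [set x; next c x] | x in [set` c]].

Definition cycle_space (G : graph) : set (edgeset G) :=
  span [set cycle_edges c | c in @is_cycle G].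

Definition bipartition (G : graph) (A B : set G) : Prop :=
  A `&` B = set0 /\ A `|` B = setT.

Definition edges_between (G : graph) (A B : set G) : edgeset G :=
  [set e | edges e /\ exists x y, [/\ A x, B y & e = [set x; y]]].

Definition cut_space (G : graph) : set (edgeset G) :=
  [set F | exists A B, [/\ bipartition A B,
                           finite_set (edges_between A B) &
                           F = edges_between A B]].

Definition Aut_orbits (G : graph) (S : set (edgeset G)) : set (edgeset G) :=
  [set F | exists f C, [/\ Aut f, S C & F = act f C]].

Definition is_Aut_module (G : graph) (M : set (edgeset G)) : Prop :=
  [/\ M set0,
      forall F H, M F -> M H -> M (F `+` H) &
      forall f F, Aut f -> M F -> M (act f F)].

Definition finitely_generated (G : graph) (M : set (edgeset G)) : Prop :=
  exists gens : seq (edgeset G),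
    [set` gens] `<=` M /\ span (Aut_orbits [set` gens]) = M.

Lemma edge_sumP (G : graph) (s : seq (edgeset G)) (e : edge G) :
  edge_sum s e <-> odd (count (fun F : edgeset G => `[< F e >]) s).
Proof.
rewrite /edge_sum; elim: s => [|F s IH]; first by rewrite big_nil.
rewrite big_cons /= oddD oddb /setY /setU /setD /=.
set E := \big[_/_]_(_ <- _) _ in IH *.
case: asboolP => Fe; case: odd IH => -[h1 h2] /=.
all: have [Ee|nEe] := pselect (E e); rewrite /is_true in h1 h2 *.
all: by intuition discriminate.
Qed.

Lemma image2 (T U : Type) (f : T -> U) x y :
  f @` [set x; y] = [set f x; f y].
Proof. by rewrite image_setU !image_set1. Qed.

Lemma image_inj_fun (T U : Type) (f : T -> U) :
  injective f -> injective (fun e : set T => f @` e).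
Proof.
move=> fI e e' E; apply/seteqP; split=> x ex.
  have : (f @` e) (f x) by exists x.
  by rewrite E => -[z e'z /fI <-].
have : (f @` e') (f x) by exists x.
by rewrite -E => -[z e'z /fI <-].
Qed.

Lemma act_setY (G : graph) (f : G -> G) (F H : edgeset G) :
  injective f -> act f (F `+` H) = act f F `+` act f H.
Proof.
move=> /image_inj_fun fI; apply/seteqP; split=> [_ [e FH <-]|e].
  case: FH => -[h1 h2]; [left|right];
    by split; [exists e | move=> [e' h /fI ?]; subst].
by case=> -[[e' h <-] n]; exists e' => //; [left|right];
  split=> // h'; apply: n; exists e'.
Qed.

Lemma act_edge_sum (G : graph) (f : G -> G) (s : seq (edgeset G)) :
  injective f -> act f (edge_sum s) = edge_sum (map (act f) s).
Proof.
move=> fI; rewrite /edge_sum; elim: s => [|F s IH] /=.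
  by rewrite !big_nil /act image_set0.
by rewrite !big_cons -IH act_setY.
Qed.

Lemma act_cycle_edges (G : graph) (f : G -> G) (c : seq G) :
  injective f -> uniq c -> act f (cycle_edges c) = cycle_edges (map f c).
Proof.
move=> fI cu; apply/seteqP; split=> [_ [_ [x xc <-] <-]|_ [y + <-]].
  by exists (f x); [exact: map_f | rewrite image2 (next_map fI)].
move=> /mapP[x xc ->]; exists [set x; next c x]; first by exists x.
by rewrite image2 (next_map fI).
Qed.

Lemma cycle_space_module (G : graph) : is_Aut_module (@cycle_space G).
Proof.
split.
- by exists [::] => //; rewrite /edge_sum big_nil.
- move=> F H [s sS <-] [t tS <-]; exists (s ++ t); last first.
    by rewrite /edge_sum big_cat.
  by move=> C /=; rewrite mem_cat => /orP[/sS|/tS].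
- move=> f F [/bij_inj fI fA] [s sS <-]; exists (map (act f) s); last first.
    by rewrite act_edge_sum.
  move=> _ /mapP[C /sS[c [cu cs cc] <-] ->]; exists (map f c).
    split; rewrite ?map_inj_uniq ?size_map // cycle_map.
    by rewrite (@eq_cycle _ _ adj) // => x y; apply: fA.
  by rewrite act_cycle_edges.
Qed.

Lemma edges_between_adj (G : graph) (A : set G) (x y : G) :
  adj x y -> edges_between A (~` A) [set x; y] <-> ~ (A x <-> A y).
Proof.
move=> xy; split.
  move=> [_ [u [v [Au Av E]]]] iA.
  have fx : [set u; v] x by rewrite -E; left.
  have fy : [set u; v] y by rewrite -E; right.
  case: fx fy => xE [] yE; rewrite xE yE ?adj_irrefl // in xy iA *.
    by apply: Av; apply/iA.
  by apply: Av; apply/iA.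
move=> nA; split; first by exists x, y.
have [Ax|Ax] := pselect (A x).
  by exists x, y; split=> //= Ay; apply: nA.
exists y, x; split=> //; last by rewrite setUC.
by apply: contrapT => Ay; apply: nA; split.
Qed.

Lemma bipartitionE (G : graph) (A B : set G) : bipartition A B <-> B = ~` A.
Proof.
split=> [[AB0 ABT]|->]; last by split; rewrite ?setICr ?setUCr.
apply/seteqP; split=> x Bx.
  by move=> Ax; have := conj Ax Bx : (A `&` B) x; rewrite AB0.
by have [] : (A `|` B) x by rewrite ABT.
Qed.

Lemma edges_betweenY (G : graph) (A C : set G) :
  edges_between A (~` A) `+` edges_between C (~` C) =
  edges_between (A `+` C) (~` (A `+` C)).
Proof.
apply/seteqP; split=> e.
  move=> H; have [x [y [xy E]]] : edges e by case: H => -[[]].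
  move: H; rewrite E /setY /setU /setD /=.
  rewrite (propext (edges_between_adj A xy)) (propext (edges_between_adj C xy)).
  move=> H; apply/(edges_between_adj _ xy) => /=.
  by have [] := pselect (A x); have [] := pselect (A y);
     have [] := pselect (C x); have [] := pselect (C y); tauto.
move=> H; have [x [y [xy E]]] : edges e by case: H.
move: H; rewrite E => /(edges_between_adj _ xy) /= H.
rewrite (propext (edges_between_adj A xy)) (propext (edges_between_adj C xy)).
by have [] := pselect (A x); have [] := pselect (A y);
   have [] := pselect (C x); have [] := pselect (C y); tauto.
Qed.

Lemma act_edges_between (G : graph) (f : G -> G) (A B : set G) :
  Aut f -> act f (edges_between A B) = edges_between (f @` A) (f @` B).
Proof.
move=> [/bij_inj fI fA]; apply/seteqP; split.
  move=> _ [_ [[x [y [xy ->]]] [u [v [Au Bv E]]]] <-]; split.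
    by exists (f x), (f y); rewrite fA image2.
  by exists (f u), (f v); rewrite E image2; split; [exists u | exists v |].
move=> e [[x [y [xy E]]] [_ [_ [[u Au <-] [v Bv <-] E']]]].
exists [set u; v]; last by rewrite image2.
split; last by exists u, v.
exists u, v; split=> //; rewrite -fA.
have fx : [set f u; f v] x by rewrite -E' E; left.
have fy : [set f u; f v] y by rewrite -E' E; right.
case: fx fy xy => -> [] ->; rewrite ?adj_irrefl //.
by rewrite adj_sym.
Qed.

Lemma cut_space_module (G : graph) : is_Aut_module (@cut_space G).
Proof.
have E0 : edges_between set0 setT = set0 :> edgeset G.
  by apply/seteqP; split=> // e [_ [x [y []]]].
split.
- by exists set0, setT; rewrite /bipartition set0I set0U E0.
- move=> _ _ [A [B [/bipartitionE -> fA ->]]] [C [D [/bipartitionE -> fC ->]]].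
  exists (A `+` C), (~` (A `+` C)); rewrite edges_betweenY; split=> //.
    exact/bipartitionE.
  rewrite -edges_betweenY /setY finite_setU.
  by split; apply: finite_setD.
- move=> f _ fA [A [B [/bipartitionE -> fin ->]]].
  have [[g fK gK] _] := fA.
  exists (f @` A), (f @` (~` A)); rewrite -act_edges_between //; split=> //.
    apply/bipartitionE/seteqP; split=> x.
      by move=> [y nA <-] [z Az /(can_inj fK) zy]; apply: nA; rewrite -zy.
    by move=> n; exists (g x) => // Ag; apply: n; exists (g x).
  exact: finite_image.
Qed.

(* Main.v *)
Require Import Defs.
From mathcomp Require Import all_boot finmap ssralg ssrnum ssrint.
From mathcomp Require Import boolp classical_sets functions cardinality.
From mathcomp Require Import zify.

(** A finite cut is the coboundary [bd A] of a vertex set [A], a side of the cut.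
    Two sides are nested if one of their four corners (intersections of the
    sides or of their complements) is empty, and cross otherwise. All cuts are
    studied in one component, since by transitivity every cut is a sum of
    translates of cuts of that component. The proof plays two facts about
    Aut-invariant families of pairwise nested sides of bonds, that is, of
    minimal nonempty cuts, against each other.

    The number of orbits of such a family [E] is bounded by a number that depends
    only on the graph. Let [A] be in [E], and let [B] range over the maximal
    members of [E] properly below [A]. If every edge of [bd A] enters one of
    these [B], then [bd A] is the disjoint union of the sets
    [bd A `&` bd B]. None of these is a cut, because [bd A] is a minimal cut
    different from [bd B]. As cuts are exactly the edge sets that meet every
    cycle evenly ([even_is_cut]), a generating cycle meets [bd A `&` bd B] in an
    odd number of edges; it meets [bd A] in an even number, so it enters [A]
    also outside [B]. Thus it contains vertices [x] outside [A], [y] in [B] and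
    [y'] in [A] but not in [B], and [A] is the least member of [E] that contains
    [y] and [y'] but not [x]. If an edge [xy] of [bd A] enters no [B], then [A] is
    the least member that contains [y] but not [x], and [xy] is a bridge or lies
    on a generating cycle ([least_branching]). So every orbit in [E] is determined
    by a triple of vertices on one of finitely many cycles or by a bridge, and
    all bridges lie in one orbit ([bridges_transitive]).

    Conversely, if the family generates all cuts with fewer than [k] edges but not
    all those with [k] edges, then it can be enlarged by a new orbit
    ([nested_system_extend]). The new side is a side of a cut with [k] edges that
    is not generated, chosen so as to cross as few others as possible; the
    numbers of crossings are finite since only finitely many bonds of given size
    contain a given edge ([finite_bonds_at]), and submodularity of the size of
    the coboundary shows that a side with crossings could be replaced by one of
    its corners, which has fewer.

    Hence a family with the largest number of orbits generates all finite
    cuts. *)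

Set Implicit Arguments.
Unset Strict Implicit.
Unset Printing Implicit Defensive.

Local Open Scope classical_set_scope.

(** * Cardinals, spans and boundaries *)

Definition ncard (T : choiceType) (A : set T) : nat := #|` fset_set A|.

Lemma ncard_le (T : choiceType) (A B : set T) :
  finite_set B -> A `<=` B -> ncard A <= ncard B.
Proof.
move=> fB AB; have fA := sub_finite_set AB fB.
by apply: fsubset_leq_card; move: AB; rewrite (fset_set_sub fA fB).
Qed.

Lemma ncard_lt (T : choiceType) (A B : set T) (x : T) :
  finite_set B -> A `<=` B -> B x -> ~ A x -> ncard A < ncard B.
Proof.
move=> fB AB Bx nAx; have fA := sub_finite_set AB fB.
apply: fproper_ltn_card; rewrite fproperEneq; apply/andP; split.
  by apply/eqP => /(fset_set_inj fA fB) E; apply: nAx; rewrite E.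
by move: AB; rewrite (fset_set_sub fA fB).
Qed.

Lemma ncard_addE (T : choiceType) (P Q : set T) :
  finite_set P -> finite_set Q ->
  ncard P + ncard Q = ncard (P `|` Q) + ncard (P `&` Q).
Proof.
by move=> fP fQ; rewrite /ncard fset_setU // fset_setI // cardfsUI.
Qed.

Lemma ncard_add_le (T : choiceType) (P Q R S : set T) :
  finite_set R -> finite_set S ->
  P `|` Q `<=` R `|` S -> P `&` Q `<=` R `&` S ->
  ncard P + ncard Q <= ncard R + ncard S.
Proof.
move=> fR fS U I.
have fU : finite_set (R `|` S) by rewrite finite_setU.
have fP : finite_set P by apply: sub_finite_set fU => x Px; apply: U; left.
have fQ : finite_set Q by apply: sub_finite_set fU => x Px; apply: U; right.
rewrite (ncard_addE fP fQ) (ncard_addE fR fS); apply: leq_add; apply: ncard_le => //.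
exact: finite_setIl.
Qed.

Lemma ncard_add_lt (T : choiceType) (P Q R S : set T) (x : T) :
  finite_set R -> finite_set S ->
  P `|` Q `<=` R `|` S -> P `&` Q `<=` R `&` S ->
  (R `|` S) x -> ~ (P `|` Q) x ->
  ncard P + ncard Q < ncard R + ncard S.
Proof.
move=> fR fS U I Ux nUx.
have fU : finite_set (R `|` S) by rewrite finite_setU.
have fP : finite_set P by apply: sub_finite_set fU => y Px; apply: U; left.
have fQ : finite_set Q by apply: sub_finite_set fU => y Px; apply: U; right.
rewrite (ncard_addE fP fQ) (ncard_addE fR fS) -addSn; apply: leq_add; first exact: ncard_lt nUx.
by apply: ncard_le => //; exact: finite_setIl.
Qed.

Lemma ncard_image (T U : choiceType) (f : T -> U) (A : set T) :
  injective f -> finite_set A -> ncard (f @` A) = ncard A.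
Proof. by move=> fI fA; rewrite /ncard fset_set_image // card_imfset. Qed.

Section Spans.
Context {G : graph}.
Implicit Types (S : set (edgeset G)) (F : edgeset G).

Lemma span0 S : span S set0.
Proof. by exists [::] => //; rewrite /edge_sum big_nil. Qed.

Lemma span_add S F F' : span S F -> span S F' -> span S (F `+` F').
Proof.
move=> [s sS <-] [t tS <-]; exists (s ++ t); last by rewrite /edge_sum big_cat.
by move=> C /=; rewrite mem_cat => /orP[/sS|/tS].
Qed.

Lemma span_gen S F : S F -> span S F.
Proof.
move=> SF; exists [:: F]; last by rewrite /edge_sum big_seq1.
by move=> C; rewrite /= inE => /eqP ->.
Qed.

Lemma span_min S (U : set (edgeset G)) :
  U set0 -> (forall F F', U F -> U F' -> U (F `+` F')) -> S `<=` U ->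
  span S `<=` U.
Proof.
move=> U0 UD SU _ [s sS <-]; elim: s sS => [|F s IH] sS.
  by rewrite /edge_sum big_nil.
rewrite /edge_sum big_cons; apply: UD.
  by apply/SU/sS; rewrite /= mem_head.
by apply: IH => C Cs; apply: sS; rewrite /= inE; apply/orP; right.
Qed.

Lemma Aut_inj (f : G -> G) : Aut f -> injective f.
Proof. by case=> /bij_inj. Qed.

Lemma Aut_comp (f g : G -> G) : Aut f -> Aut g -> Aut (f \o g).
Proof.
move=> [bf af] [bg ag]; split; first exact: bij_comp.
by move=> x y; rewrite /= af ag.
Qed.

Lemma Aut_id : Aut (@id G).
Proof. by split; [exists id|]. Qed.

Lemma Aut_inv (f : G -> G) :
  Aut f -> exists g, [/\ Aut g, cancel f g & cancel g f].
Proof.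
move=> [[g fg gf] af]; exists g; split=> //; split; first by exists f.
by move=> x y; rewrite -af !gf.
Qed.

Lemma act_comp (f g : G -> G) F : act (f \o g) F = act f (act g F).
Proof.
by rewrite /act image_comp; apply: eq_imagel => e _; rewrite /= image_comp.
Qed.

Lemma span_orbits_module S : is_Aut_module (span (Aut_orbits S)).
Proof.
split; [exact: span0 | exact: span_add |].
move=> f F fA; move: F; apply: span_min.
- by rewrite /act image_set0; exact: span0.
- by move=> F F' ? ?; rewrite act_setY; [apply: span_add | exact: Aut_inj].
move=> _ [g [C [gA SC ->]]]; apply: span_gen; exists (f \o g), C.
by rewrite act_comp; split=> //; apply: Aut_comp.
Qed.

End Spans.

Section Boundary.
Context {G : graph}.
Implicit Types (A B D : set G) (x y : G).

(** The coboundary of the vertex set [A]; it depends on [A] only up to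
    complement, and [A] is called a side of the cut. *)
Definition bd A : edgeset G := edges_between A (~` A).

Lemma bd_adj A x y : adj x y -> bd A [set x; y] <-> ~ (A x <-> A y).
Proof. exact: edges_between_adj. Qed.

Lemma bdP A (e : edge G) :
  bd A e -> exists x y, [/\ adj x y, A x, ~ A y & e = [set x; y]].
Proof.
move=> [[x [y [xy ->]]] H]; have /(bd_adj _ xy) N : bd A [set x; y].
  by split=> //; exists x, y.
have [Ax|nAx] := pselect (A x).
  by exists x, y; split=> // Ay; apply: N.
exists y, x; rewrite adj_sym; split=> //; last by rewrite setUC.
by apply: contrapT => nAy; apply: N.
Qed.

Lemma bd_edges A : bd A `<=` @edges G.
Proof. by move=> e []. Qed.

Lemma sub_edges (F F' : edgeset G) : F `<=` @edges G ->
  (forall x y, adj x y -> F [set x; y] -> F' [set x; y]) -> F `<=` F'.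
Proof.
move=> Fe H e Fee; have [x [y [xy E]]] := Fe _ Fee.
by move: Fee; rewrite E; apply: H.
Qed.

Lemma bd_eq A B :
  (forall x y, adj x y -> ((A x <-> A y) <-> (B x <-> B y))) -> bd A = bd B.
Proof.
move=> H; apply/seteqP; split; apply: (sub_edges (@bd_edges _)) => x y xy;
  by move=> /(bd_adj _ xy) N; apply/(bd_adj _ xy); have := H _ _ xy; tauto.
Qed.

Lemma bdY A B : bd A `+` bd B = bd (A `+` B).
Proof. exact: edges_betweenY. Qed.

Lemma act_bd (f : G -> G) A : Aut f -> act f (bd A) = bd (f @` A).
Proof.
move=> fA; rewrite /bd act_edges_between //; congr edges_between.
have [[g fK gK] _] := fA; apply/seteqP; split=> x.
  by move=> [y nA <-] [z Az /(can_inj fK) zy]; apply: nA; rewrite -zy.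
by move=> n; exists (g x) => // Ag; apply: n; exists (g x).
Qed.

Lemma cut_space_bd A : finite_set (bd A) -> cut_space (bd A).
Proof. by move=> fA; exists A, (~` A); split=> //; apply/bipartitionE. Qed.

Lemma cut_spaceP (F : edgeset G) :
  cut_space F -> exists2 A, finite_set (bd A) & F = bd A.
Proof. by move=> [A [B [/bipartitionE -> fA ->]]]; exists A. Qed.

(** An edge of [bd (A `&` B)] or of [bd (A `|` B)] has its ends separated by [A]
    or by [B], and by both if it lies in both, so it is enough to count edge by
    edge. *)
Lemma submodular A B : finite_set (bd A) -> finite_set (bd B) ->
  ncard (bd (A `&` B)) + ncard (bd (A `|` B)) <= ncard (bd A) + ncard (bd B).
Proof.
move=> fA fB; apply: ncard_add_le => //.
  move=> e H; have [x [y [xy E]]] : edges e by case: H => /bd_edges.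
  move: H; rewrite E => -[] /(bd_adj _ xy) /= N; rewrite /setU /=;
  rewrite (propext (bd_adj A xy)) (propext (bd_adj B xy));
  by have [] := pselect (A x); have [] := pselect (A y);
   have [] := pselect (B x); have [] := pselect (B y); tauto.
move=> e H; have [x [y [xy E]]] : edges e by case: H => /bd_edges.
move: H; rewrite E => -[] /(bd_adj _ xy) /= N /(bd_adj _ xy) /= N'.
rewrite /setI /=;
  rewrite (propext (bd_adj A xy)) (propext (bd_adj B xy));
  by have [] := pselect (A x); have [] := pselect (A y);
   have [] := pselect (B x); have [] := pselect (B y); tauto.
Qed.

End Boundary.

(** * Components, walks and the cut criterion *)

Lemma xor_iff (b c : bool) : ~ (b <-> c) <-> b (+) c.
Proof.
by case: b; case: c; split=> //; [case|move=> _ [/(_ isT)]|move=> _ [_ /(_ isT)]|case].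
Qed.

Section Components.
Context {G : graph}.
Implicit Types (A B : set G) (o x y : G) (p q : seq G) (F : edgeset G).

Definition component o : set G := [set v | exists2 p, path adj o p & last o p = v].

Lemma component_refl o : component o o.
Proof. by exists [::]. Qed.

Lemma component_adj o x y : adj x y -> component o x -> component o y.
Proof.
move=> xy [p pp px]; exists (rcons p y); last by rewrite last_rcons.
by rewrite rcons_path pp px.
Qed.

Lemma component_adjE o x y : adj x y -> component o x <-> component o y.
Proof. by move=> xy; split; apply: component_adj => //; rewrite adj_sym. Qed.

Lemma component_ind o (P : G -> Prop) :
  P o -> (forall x y, component o x -> P x -> adj x y -> P y) ->
  forall v, component o v -> P v.
Proof.
move=> Po step v [p + <-]; elim/last_ind: p => [|p y IH] //.
rewrite rcons_path last_rcons => /andP[pp xy].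
by apply: step xy; [exists p | exact: IH].
Qed.

Lemma component_trans o x y : component o x -> component x y -> component o y.
Proof. by move=> ox; apply: component_ind => // u v _ + uv; apply: component_adj. Qed.

Lemma component_sym o x : component o x -> component x o.
Proof.
move: x; apply: component_ind => [|x y _ xo xy]; first exact: component_refl.
apply: component_trans xo; rewrite adj_sym in xy.
by apply: (component_adj xy); exact: component_refl.
Qed.

Lemma component_eq o x : component o x -> component x = component o.
Proof.
move=> ox; apply/seteqP; split=> y; first exact: component_trans.
by apply: component_trans; apply: component_sym.
Qed.

Lemma image_component_Aut f o : Aut f -> f @` component o = component (f o).
Proof.
move=> fA; have imc (g : G -> G) v : Aut g -> g @` component v `<=` component (g v).
  move=> [_ ga] _ [u vu <-]; move: u vu; apply: component_ind.
    exact: component_refl.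
  by move=> x y _ H xy; apply: component_adj H; rewrite ga.
apply/seteqP; split; first exact: imc.
have [g [gA fg gf]] := Aut_inv fA.
move=> y H; exists (g y) => //; rewrite -[o in component o]fg.
by apply: imc => //; exists y.
Qed.

(** A component has no proper cut without edges: membership in [A] propagates
    along walks. *)
Lemma bd_set0_component o A :
  A `<=` component o -> bd A = set0 -> A = set0 \/ A = component o.
Proof.
move=> AH A0; have st x y : adj x y -> A x -> A y.
  move=> xy Ax; apply: contrapT => nAy.
  have : bd A [set x; y] by apply/(bd_adj _ xy); tauto.
  by rewrite A0.
have [[x Ax]|N] := pselect (exists x, A x); [right|left].
  apply/seteqP; split=> // y; rewrite -(component_eq (AH _ Ax)).
  by move: y; apply: component_ind => // u v _ + uv; apply: st.
by apply/seteqP; split=> // x Ax; apply: N; exists x.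
Qed.

(** No edge leaves a component. *)
Lemma bd_componentD o A : A `<=` component o -> bd (component o `\` A) = bd A.
Proof.
move=> AH; apply: bd_eq => x y xy /=; have := component_adjE o xy.
have := AH x; have := AH y; rewrite /setD /=.
by have [] := pselect (A x); have [] := pselect (A y); tauto.
Qed.

Lemma bd_inj_component o A B : A `<=` component o -> B `<=` component o ->
  bd A = bd B -> A = B \/ A = component o `\` B.
Proof.
move=> AH BH E.
have [] := @bd_set0_component o (A `+` B).
- by move=> x [[/AH]|[/BH]].
- by rewrite -bdY E setYK.
- by move=> E0; left; rewrite -[LHS]setY0 -(setYK B) setYA E0 set0Y.
- move=> E1; right; apply/seteqP; split=> x; have := AH x; have := BH x;
  rewrite -E1 /setY /setU /setD /=;
  by have [] := pselect (A x); have [] := pselect (B x); tauto.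
Qed.

Fixpoint walk_parity F x p : bool :=
  if p is y :: p' then `[< F [set x; y] >] (+) walk_parity F y p' else false.

Lemma walk_parity_cat F x p q :
  walk_parity F x (p ++ q) = walk_parity F x p (+) walk_parity F (last x p) q.
Proof. by elim: p x => //= y p IH x; rewrite IH addbA. Qed.

Lemma walk_parity_rcons F x p y :
  walk_parity F x (rcons p y) = walk_parity F x p (+) `[< F [set last x p; y] >].
Proof. by rewrite -cats1 walk_parity_cat /= addbF. Qed.

Lemma walk_parity_bd A x p : path adj x p ->
  walk_parity (bd A) x p = `[< A x >] (+) `[< A (last x p) >].
Proof.
elim: p x => /= [|y p IH] x; first by rewrite addbb.
move=> /andP[xy /IH ->]; rewrite (propext (bd_adj _ xy)).
have -> : `[< ~ (A x <-> A y) >] = `[< A x >] (+) `[< A y >].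
  by case: (asboolP (A x)) => Ax; case: (asboolP (A y)) => Ay /=;
    [apply: asboolF|apply: asboolT|apply: asboolT|apply: asboolF]; tauto.
by rewrite -addbA addKb.
Qed.

Lemma walk_parity_rev F x p : walk_parity F (last x p) (rev (belast x p)) = walk_parity F x p.
Proof.
elim: p x => //= y p IH x; rewrite rev_cons walk_parity_rcons IH addbC; congr (`[< F _ >] (+) _).
by case: p {IH} => [|z p] /=; rewrite ?rev_cons ?last_rcons setUC.
Qed.

Lemma walk_parity_exists F x p : walk_parity F x p -> path adj x p ->
  exists u v, [/\ u \in x :: p, v \in x :: p, adj u v & F [set u; v]].
Proof.
elim: p x => //= y p IH x + /andP[xy yp]; case: asboolP => /= [Fxy _|_ H].
  by exists x, y; rewrite !inE !eqxx orbT.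
have [u [v [up vp uv Fuv]]] := IH _ H yp.
by exists u, v; rewrite inE up orbT inE vp orbT.
Qed.

Lemma nuniq_split (T : eqType) (s : seq T) : ~~ uniq s ->
  exists l1 z l2 l3, s = l1 ++ z :: l2 ++ z :: l3.
Proof.
elim: s => //= x s IH; rewrite negb_and negbK.
case: (boolP (x \in s)) => /= [/splitPr [p q] _|_ /IH [l1 [z [l2 [l3 ->]]]]].
  by exists [::], x, p, q.
by exists (x :: l1), z, l2, l3.
Qed.

(** The closed walk is given by the list of its vertices without the final
    return to its head, as for cycles. *)
Definition cycle_parity F (c : seq G) : bool :=
  if c is x :: p then walk_parity F x (rcons p x) else false.

(** A closed walk either is a cycle, or goes back and forth along one edge, or
    repeats a vertex; in the last case it is the sum of two shorter closed
    walks. *)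
Lemma closed_walk_even F :
  (forall c, is_cycle c -> cycle_parity F c = false) ->
  forall x p, path adj x p -> last x p = x -> walk_parity F x p = false.
Proof.
move=> even x p; have [n] := ubnP (size p); elim: n x p => // n IH x p.
case/lastP: p => // q z; rewrite size_rcons ltnS => sq pq.
rewrite last_rcons => zx; subst z.
have [u|/nuniq_split [l1 [z [l2 [l3 E]]]]] := boolP (uniq (x :: q)).
  have [s|s] := ltnP 2 (size (x :: q)).
    by apply: (even (x :: q)); split.
  case: q sq u s pq => [|y [|//]] sq u s /=; first by rewrite adj_irrefl.
  by rewrite setUC addbF addbb.
case: l1 E => [|x' l1] /= [? E]; subst.
  move: sq pq; rewrite rcons_cat rcons_cons.
  rewrite -!cat_rcons cat_path last_rcons walk_parity_cat last_rcons size_cat size_rcons.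
  move=> sq /andP[pq1 pq2]; rewrite !IH ?last_rcons ?size_rcons //.
    by apply: leq_ltn_trans sq; rewrite addSn ltnS leq_addl.
  by apply: leq_ltn_trans sq; rewrite leq_addr.
move: sq pq; rewrite -!cat_rcons !rcons_cat !cat_path !last_rcons.
rewrite !walk_parity_cat !last_rcons !size_cat !size_rcons => sq /and3P[p1 p2 p3].
rewrite (IH z (rcons l2 z)) ?last_rcons ?size_rcons //; last by lia.
have := IH x' (rcons l1 z ++ rcons l3 x'); rewrite walk_parity_cat last_rcons addFb.
apply.
- by rewrite size_cat !size_rcons; lia.
- by rewrite cat_path p1 last_rcons.
- by rewrite last_cat !last_rcons.
Qed.

(** If [F] is even on all closed walks, the parity of a walk from [o] depends only on its end,
    and the vertices of odd parity form a side of [F]. *)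
Lemma even_is_cut o F : F `<=` @edges G ->
  (forall x y, F [set x; y] -> component o x) ->
  (forall c, is_cycle c -> cycle_parity F c = false) ->
  exists2 A, A `<=` component o & F = bd A.
Proof.
move=> Fe Fo even.
pose A := [set v | exists p, [/\ path adj o p, last o p = v & walk_parity F o p]].
have wd p q : path adj o p -> path adj o q -> last o p = last o q ->
    walk_parity F o p = walk_parity F o q.
  move=> pp pq E; suff : walk_parity F o p (+) walk_parity F o q = false.
    by case: (walk_parity F o p); case: (walk_parity F o q).
  rewrite -(walk_parity_rev F o q) -E -walk_parity_cat; apply: closed_walk_even => //.
    rewrite cat_path pp E rev_path.
    by rewrite (@eq_path _ _ adj) // => u v; rewrite adj_sym.
  by rewrite last_cat E; case: (q) => //= z r; rewrite rev_cons last_rcons.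
exists A; first by move=> v [p [pp <- _]]; exists p.
have key x y : adj x y -> component o x -> F [set x; y] <-> ~ (A x <-> A y).
  move=> xy [p pp px].
  have Ax : A x <-> walk_parity F o p.
    split; last by exists p.
    by move=> [q [pq qx wq]]; rewrite (wd p q) // px.
  have Ay : A y <-> walk_parity F o (rcons p y).
    split; last by exists (rcons p y); rewrite rcons_path last_rcons pp px.
    by move=> [q [pq qx wq]]; rewrite (wd _ q) // ?last_rcons // rcons_path pp px.
  rewrite (propext Ax) (propext Ay) walk_parity_rcons px.
  rewrite (propext (xor_iff _ _)) addKb; exact: (rwP (asboolP _)).
apply/seteqP; split; [apply: (sub_edges Fe)|apply: (sub_edges (@bd_edges _ _))].
  move=> x y xy Fxy; apply/(bd_adj _ xy); apply/(key _ _ xy) => //.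
  exact: Fo Fxy.
move=> x y xy /(bd_adj _ xy) N; apply/(key _ _ xy) => //.
have AH v : A v -> component o v by move=> [p [pp <- _]]; exists p.
have := AH x; have := AH y; have := component_adjE o xy.
by have [] := pselect (A x); have [] := pselect (A y); tauto.
Qed.

End Components.

(** * Parity along the generating cycles *)

(** For a fixed finite set [F], this makes the parity of [F `&` C] additive in
    [C], so that orthogonality to [F] passes from generators to their span. *)
Lemma odd_ncardY (T : choiceType) (A B : set T) : finite_set A -> finite_set B ->
  odd (ncard (A `+` B)) = odd (ncard A) (+) odd (ncard B).
Proof.
move=> fA fB.
have fD : finite_set (A `+` B) by rewrite finite_setU; split; apply: finite_setD.
have fI : finite_set (A `&` B) by exact: finite_setIl.
have E : ncard A + ncard B = ncard (A `+` B) + (ncard (A `&` B)).*2.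
  rewrite (ncard_addE fA fB) -addnn addnA; congr (_ + _).
  rewrite (ncard_addE fD fI); have -> : (A `+` B) `&` (A `&` B) = set0.
    by apply/seteqP; split=> x // [[[? ?]|[? ?]] []].
  rewrite [X in _ + X]/ncard fset_set0 cardfs0 addn0; congr ncard.
  apply/seteqP; split=> x; rewrite /setY /setU /setD /setI /=;
    by have [] := pselect (A x); have [] := pselect (B x); tauto.
by rewrite -oddD E oddD odd_double addbF.
Qed.

Section Generators.
Context {G : graph}.
Implicit Types (F : edgeset G) (c : seq G).

Lemma walk_parity_count F x p :
  walk_parity F x p = odd (count (fun e : edge G => `[< F e >])
                      (pairmap (fun u v : G => [set u; v]) x p)).
Proof. by elim: p x => //= y p -> x; rewrite oddD oddb. Qed.

Lemma cycle_pairs (x : G) p : uniq (x :: p) ->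
  pairmap (fun u v : G => [set u; v]) x (rcons p x) =
  [seq [set y; next (x :: p) y] | y <- x :: p].
Proof.
move=> u; apply: (@eq_from_nth _ set0).
  by rewrite size_pairmap size_map size_rcons.
move=> i; rewrite size_pairmap size_rcons => ip.
rewrite (nth_pairmap x) ?size_rcons // (nth_map x) //.
rewrite next_nth mem_nth // index_uniq // nth_rcons -rcons_cons nth_rcons /= ip.
case: ltnP => // pi; rewrite (nth_default _ pi); by case: ifP.
Qed.

(** The edges of a cycle are pairwise distinct because its length is at least
    three; a walk back and forth along one edge would use it twice. *)
Lemma cycle_next_inj c : uniq c -> 2 < size c ->
  {in c &, injective (fun y => [set y; next c y])}.
Proof.
move=> u s x y xc yc E; apply: contrapT => nxy.
have yn : y = next c x.
  have : [set x; next c x] y by rewrite E; left.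
  by case=> // yx; case: nxy.
have xn : x = next c y.
  have : [set y; next c y] x by rewrite -E; left.
  by case.
have : next c (next c x) = x by rewrite -yn -xn.
have [i c' rc] := rot_to xc.
have N y0 : next c y0 = next (rot i c) y0 by rewrite next_rot.
rewrite !N rc.
have : uniq (rot i c) by rewrite rot_uniq.
have : 2 < size (rot i c) by rewrite size_rot.
rewrite rc; case: c' {rc N} => [|y1 [|y2 c']] //= _.
rewrite !inE !negb_or eqxx => /and3P[/and3P[n1 n2 _] _ _].
by rewrite (negbTE (_ : y1 != x)) 1?eq_sym // eqxx => E2; rewrite E2 eqxx in n2.
Qed.

Lemma cycle_parity_ncard F c : is_cycle c -> cycle_parity F c = odd (ncard (F `&` cycle_edges c)).
Proof.
move=> [u s _]; case: c u s => // x p u s.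
rewrite /cycle_parity walk_parity_count cycle_pairs // -size_filter; congr odd.
set t := filter _ _.
have tu : uniq t by apply/filter_uniq; rewrite map_inj_in_uniq //; apply: cycle_next_inj.
have -> : F `&` cycle_edges (x :: p) = [set` t].
  apply/seteqP; split=> e.
    move=> [Fe [y yc ye]]; rewrite /= mem_filter; apply/andP; split; first exact/asboolP.
    by rewrite -ye; apply/mapP; exists y.
  rewrite /= mem_filter => /andP[/asboolP Fe /mapP[y yc E]].
  rewrite E in Fe *.
  by split; [exact: Fe | exists y].
have -> : [set` t] = [set` seq_fset tt t].
  by apply/seteqP; split=> e /= et; have := seq_fsetE tt t e; rewrite et.
by rewrite /ncard set_fsetK size_seq_fset undup_id.
Qed.

Lemma span_mono (S S' : set (edgeset G)) : S `<=` S' -> span S `<=` span S'.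
Proof.
move=> SS'; apply: span_min; [exact: span0 | exact: span_add |].
by move=> F /SS' ?; apply: span_gen.
Qed.

Definition cycles_of (cs : seq (seq G)) : set (edgeset G) :=
  [set cycle_edges c | c in [set` cs]].

Lemma span_finitely_many_cycles (C : edgeset G) : cycle_space C ->
  exists cs : seq (seq G), (forall c, c \in cs -> is_cycle c) /\ span (cycles_of cs) C.
Proof.
move: C; apply: span_min.
- by exists [::]; split=> //; exact: span0.
- move=> C C' [s [sc sC]] [t [tc tC]]; exists (s ++ t); split.
    by move=> c; rewrite mem_cat => /orP[/sc|/tc].
  by apply: span_add; [move: C sC {tC} | move: C' tC {sC}]; apply: span_mono;
    move=> _ [c cc <-]; exists c => //=; rewrite mem_cat; apply/orP; [left|right].
move=> _ [c cc <-]; exists [:: c]; split.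
  by move=> d; rewrite inE => /eqP ->.
by apply: span_gen; exists c => //=; rewrite mem_head.
Qed.

Lemma is_cycle_map (f : G -> G) c : Aut f -> is_cycle c -> is_cycle (map f c).
Proof.
move=> fA [cu cs cc]; split; rewrite ?map_inj_uniq ?size_map //; first exact: Aut_inj.
by rewrite cycle_map (@eq_cycle _ _ adj) // => x y; apply: fA.2.
Qed.

Lemma cycle_parity_map (F : edgeset G) (f : G -> G) c : is_cycle c -> Aut f ->
  cycle_parity F (map f c) = odd (ncard (F `&` act f (cycle_edges c))).
Proof.
move=> cc fA; have [cu _ _] := cc; rewrite act_cycle_edges //; last exact: Aut_inj.
by rewrite cycle_parity_ncard //; exact: is_cycle_map.
Qed.

(** Generators of the cycle space may be replaced by the finitely many cycles
    of which they are sums. A finite edge set that is even on all translates of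
    these cycles is even on every cycle. *)
Lemma cycle_representatives : finitely_generated (@cycle_space G) ->
  exists2 cs : seq (seq G), (forall c, c \in cs -> is_cycle c) &
  forall F, finite_set F ->
    (forall c f, c \in cs -> Aut f -> cycle_parity F (map f c) = false) ->
    forall c, is_cycle c -> cycle_parity F c = false.
Proof.
move=> [gens [gC gE]].
have [cs [csc csg]] : exists cs : seq (seq G), (forall c, c \in cs -> is_cycle c) /\
    forall g, g \in gens -> span (cycles_of cs) g.
  have : forall g, g \in gens -> cycle_space g by move=> g; apply: gC.
  elim: gens {gC gE} => [|g gens IH] gC; first by exists [::].
  have [|s [sc sC]] := IH; first by move=> h hg; apply: gC; rewrite inE hg orbT.
  have [|t [tc tC]] := @span_finitely_many_cycles g; first by apply: gC; rewrite mem_head.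
  exists (t ++ s); split; first by move=> c; rewrite mem_cat => /orP[/tc|/sc].
  have sub r : {subset r <= t ++ s} -> span (cycles_of r) `<=` span (cycles_of (t ++ s)).
    by move=> rs; apply: span_mono => _ [c cc <-]; exists c => //=; apply: rs.
  move=> h; rewrite inE => /orP[/eqP ->|/sC hC]; [apply: sub tC|apply: sub hC];
    by move=> c cr; rewrite mem_cat cr ?orbT.
exists cs => // F fF even c cc.
pose U := [set C : edgeset G | odd (ncard (F `&` C)) = false].
have U0 : U set0 by rewrite /U /= setI0 /ncard fset_set0 cardfs0.
have UD C C' : U C -> U C' -> U (C `+` C').
  move=> UC UC'; rewrite /U /= setIC setIYl odd_ncardY; try exact: finite_setIr.
  by rewrite ![_ `&` F]setIC UC UC'.
rewrite cycle_parity_ncard //; have : cycle_space (cycle_edges c) by apply: span_gen; exists c.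
rewrite -gE; move: (cycle_edges c); apply: span_min => //.
move=> _ [f [g [fA /csg gS ->]]]; move: g gS.
change (span (cycles_of cs) `<=` [set g | U (act f g)]); apply: span_min.
- by rewrite /= /act image_set0.
- by move=> C C' /= ? ?; rewrite act_setY; [apply: UD | exact: Aut_inj].
by move=> _ [d dc <-]; rewrite /U /= -cycle_parity_map ?even //; apply: csc.
Qed.

End Generators.

(** * Bonds and nestedness *)

Section Bonds.
Context {G : graph}.
Implicit Types (A B D : set G) (F : edgeset G) (o x y : G).

Lemma cycle_parity_bd A c : is_cycle c -> cycle_parity (bd A) c = false.
Proof.
case: c => // x p [_ _ cp]; rewrite /cycle_parity walk_parity_bd // last_rcons; exact: addbb.
Qed.

Definition bond o A : Prop :=
  [/\ A `<=` component o, finite_set (bd A), bd A !=set0 &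
      forall B, bd B `<=` bd A -> bd B = set0 \/ bd B = bd A].

Lemma bondC o A : bond o A -> bond o (component o `\` A).
Proof.
move=> [AH fA nA mA]; by rewrite /bond bd_componentD.
Qed.

Lemma finite_cycle_edges (c : seq G) : finite_set (cycle_edges c).
Proof. by apply: finite_image; exact: finite_seq. Qed.

(** Induction on the number [k] of edges that are still to be added to [F].
    If [F] is even on all cycles, it is a cut, hence the only bond that
    contains it. Otherwise some cycle meets [F] in an odd number of edges, and
    every bond that contains [F] has to contain a further edge of this one
    finite cycle. *)
Lemma finite_bonds_through o k F : finite_set F -> F !=set0 ->
  finite_set [set bd A | A in [set A | [/\ bond o A, F `<=` bd A &
                                         ncard (bd A) <= ncard F + k]]].
Proof.
elim: k F => [|k IH] F fF nF.
  apply: (@sub_finite_set _ _ [set F]); last exact: finite_set1.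
  move=> _ [A [[_ fA _ _] FA]] + <-; rewrite addn0 => le.
  apply/seteqP; split=> // e Ae; apply: contrapT => nFe.
  by have := ncard_lt fA FA Ae nFe; rewrite ltnNge le.
have [[c [cc co]]|even] := pselect (exists c, is_cycle c /\ cycle_parity F c).
  apply: (@sub_finite_set _ _ (\bigcup_(e in cycle_edges c `\` F)
    [set bd A | A in [set A | [/\ bond o A, (e |` F) `<=` bd A &
                                 ncard (bd A) <= ncard (e |` F) + k]]])); last first.
    apply: bigcup_finite; first by apply: finite_setD; exact: finite_cycle_edges.
    move=> e _; apply: IH; first by rewrite finite_setU.
    by exists e; left.
  move=> _ [A [bA FA le] <-].
  have [e [ce Ae nFe]] : exists e, [/\ cycle_edges c e, bd A e & ~ F e].
    apply: contrapT => N; have := cycle_parity_bd A cc.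
    suff E : bd A `&` cycle_edges c = F `&` cycle_edges c.
      by rewrite cycle_parity_ncard // E -cycle_parity_ncard // co.
    apply/seteqP; split=> e [h ce]; split=> //; last exact: FA.
    by apply: contrapT => nFe; apply: N; exists e.
  exists e; first by split.
  exists A => //; split=> //; first by move=> f [->|/FA].
  suff -> : ncard (e |` F) = (ncard F).+1 by rewrite addSnnS.
  have eF : (e \in F) = false by apply/negP; rewrite inE.
  by rewrite /ncard fset_setU1 // cardfsU1 in_fset_set // eF add1n.
have [[B [bB FB]]|N] := pselect (exists B, bond o B /\ F `<=` bd B); last first.
  rewrite [X in finite_set X](_ : _ = set0); first exact: finite_set0.
  by apply/seteqP; split=> // f [B [bB FB _] _]; apply: N; exists B.
have [|||C CH FC] := @even_is_cut _ o F.
- by move=> e /FB /bd_edges.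
- move=> x y /FB /bdP[u [v [uv Bu _ E]]]; have [BH _ _ _] := bB.
  have : [set u; v] x by rewrite -E; left.
  by case=> ->; [|rewrite -(component_adjE _ uv)]; apply: BH.
- by move=> c cc; case co: (cycle_parity F c) => //; case: even; exists c.
apply: (@sub_finite_set _ _ [set F]); last exact: finite_set1.
move=> _ [A [[_ _ _ mA] FA _] <-]; rewrite /= FC in FA *.
by case: (mA _ FA) => // E; case: nF => e; rewrite FC E.
Qed.

(** A cut of a component has just two sides. *)
Lemma finite_sides o F : finite_set [set A | A `<=` component o /\ bd A = F].
Proof.
have [[B [BH BF]]|N] := pselect (exists B, B `<=` component o /\ bd B = F); last first.
  rewrite [X in finite_set X](_ : _ = set0); first exact: finite_set0.
  by apply/seteqP; split=> // B ?; apply: N; exists B.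
apply: (@sub_finite_set _ _ [set B; component o `\` B]).
  by move=> A [AH AF]; apply: bd_inj_component => //; rewrite AF BF.
by rewrite finite_setU; split; exact: finite_set1.
Qed.

Lemma finite_bonds_at o k (e : edge G) :
  finite_set [set A | [/\ bond o A, bd A e & ncard (bd A) <= k]].
Proof.
pose bds := [set bd A | A in [set A | [/\ bond o A, [set e] `<=` bd A &
                                 ncard (bd A) <= ncard [set e] + k]]].
apply: (@sub_finite_set _ _ (\bigcup_(F in bds) [set A | A `<=` component o /\ bd A = F])).
  move=> A [bA Ae le]; exists (bd A); last by split=> //; case: bA.
  exists A => //; split=> //; first by move=> f ->.
  by apply: leq_trans le _; exact: leq_addl.
apply: bigcup_finite => [|F _]; last exact: finite_sides.
by apply: finite_bonds_through; [exact: finite_set1 | exists e].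
Qed.

(** One of the four corners of [A] and [B] in the component is empty. *)
Definition nested o A B : Prop :=
  [\/ forall x, A x -> ~ B x, forall x, A x -> B x, forall x, B x -> A x |
     forall x, component o x -> A x \/ B x].

Lemma nested_sym o A B : nested o A B -> nested o B A.
Proof.
case=> H; [apply: Or41|apply: Or43|apply: Or42|apply: Or44] => //.
- by move=> x Bx /H.
- by move=> x /H; tauto.
Qed.

Lemma nestedC o A B : A `<=` component o -> nested o A B -> nested o A (component o `\` B).
Proof.
move=> AH; case=> H; [apply: Or42|apply: Or41|apply: Or44|apply: Or43] => x;
  have := H x; have := AH x; rewrite /setD /=;
  by have [] := pselect (A x); have [] := pselect (B x); tauto.
Qed.

Lemma not_nestedP o A B : ~ nested o A B ->
  [/\ exists x, A x /\ B x, exists x, A x /\ ~ B x, exists x, ~ A x /\ B x &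
      exists x, [/\ component o x, ~ A x & ~ B x]].
Proof.
move=> N; split; apply: contrapT => E; apply: N.
- by apply: Or41 => x Ax Bx; apply: E; exists x.
- by apply: Or42 => x Ax; apply: contrapT => Bx; apply: E; exists x.
- by apply: Or43 => x Bx; apply: contrapT => Ax; apply: E; exists x.
- apply: Or44 => x Hx; apply: contrapT => Nx; apply: E; exists x.
  by split=> // ?; apply: Nx; [left|right].
Qed.

(** Taking a corner creates no crossing, provided the opposite corner is
    nonempty: [D] could cross the corner only if it lay in one of [A] and [B]
    and its complement in the other, and then [A] and [B] would cover the
    component. *)
Lemma nested_corner o D A B : 
  nested o D A -> nested o D B -> (exists z, [/\ component o z, ~ A z & ~ B z]) ->
  nested o D (A `&` B).
Proof.
move=> nA nB [z [zH nAz nBz]].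
case: nA => HA; [| |apply: Or43; by move=> x [Ax _]; apply: HA|].
- by apply: Or41 => x /HA nAx [].
- case: nB => HB.
  + by apply: Or41 => x /HB nBx [].
  + by apply: Or42 => x Dx; split; [apply: HA|apply: HB].
  + by apply: Or43 => x [_ /HB].
  + by case: (HB z zH) => // /HA.
- case: nB => HB.
  + by apply: Or41 => x /HB nBx [].
  + by case: (HA z zH) => // /HB.
  + by apply: Or43 => x [_ /HB].
  + apply: Or44 => x xH; have := HA x xH; have := HB x xH; rewrite /setI /=; tauto.
Qed.

(** A set nested with [A] lies, up to complement, inside [A] or outside [A], so
    it cannot cross corners on both sides of [A]. *)
Lemma nested_opposite o D A B : D `<=` component o ->
  nested o D A ->
  nested o D (A `&` B) \/ nested o D ((component o `\` A) `&` (component o `\` B)).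
Proof.
move=> DH; case=> H.
- by left; apply: Or41 => x /H nA [].
- by right; apply: Or41 => x /H Ax [[]].
- by left; apply: Or43 => x [/H].
- by right; apply: Or43 => x [[xH nA] _]; case: (H x xH).
Qed.

Lemma walk_through o (l : seq G) : [set` l] `<=` component o ->
  exists2 p, path adj o p & {subset l <= o :: p}.
Proof.
elim: l => [|v l IH] lH; first by exists [::].
have [|p pp lp] := IH; first by move=> x xl; apply: lH; rewrite /= inE xl orbT.
have ov : component o v by apply: lH; rewrite /= mem_head.
have [q pq qv] : component (last o p) v.
  by rewrite (@component_eq _ o) //; exists p.
exists (p ++ q); first by rewrite cat_path pp.
move=> x; rewrite inE => /orP[/eqP ->|/lp]; last by rewrite -cat_cons mem_cat => ->.
rewrite -cat_cons mem_cat -qv; case: (q) => [|y r]; first by rewrite /= mem_last.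
by rewrite /= mem_last orbT.
Qed.

Lemma walk_one_side B x p :
  path adj x p -> (forall e, e \in pairmap (fun u v : G => [set u; v]) x p -> ~ bd B e) ->
  forall v, v \in x :: p -> B v <-> B x.
Proof.
elim: p x => [|y p IH] x /=; first by move=> _ _ v; rewrite inE => /eqP ->.
move=> /andP[xy yp] nB v; rewrite inE => /orP[/eqP -> //|vp].
rewrite (IH y yp) //; last by move=> e ep; apply: nB; rewrite inE ep orbT.
apply: contrapT => N; apply: (nB [set x; y]); first by rewrite mem_head.
by apply/(bd_adj _ xy); tauto.
Qed.

(** If [B] crosses [A] but contains no end of an edge of [bd A], then every
    edge of [bd (A `&` B)] lies in [bd B], and minimality of [bd B] forces
    [A `&` B] to be empty or equal to [B]. *)
Lemma bond_off_ends o A B : A `<=` component o -> bond o B ->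
  (forall x y, adj x y -> bd A [set x; y] -> ~ B x) -> nested o A B.
Proof.
move=> AH [BH fB nB mB] off; apply: contrapT => /not_nestedP[[x [Ax Bx]] _ [z [nAz Bz]] _].
have sub : bd (A `&` B) `<=` bd B.
  apply: (sub_edges (@bd_edges _ _)) => u v uv /(bd_adj _ uv) /= N.
  apply/(bd_adj _ uv) => E; have [] := pselect (A u <-> A v); first by tauto.
  move=> nA; have uvA : bd A [set u; v] by apply/(bd_adj _ uv).
  by have := off _ _ uv uvA; have := E; tauto.
case: (mB _ sub) => E.
- have [|E'|E'] := @bd_set0_component _ o (A `&` B) _ E; first by move=> ? [/AH].
  + by have : (A `&` B) x by []; rewrite E'.
  + by have := BH _ Bz; rewrite -E' => -[].
- have [||E'|E'] := @bd_inj_component _ o (A `&` B) B _ _ E; [by move=> ? [/AH]|by []| |].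
  + by have := Bz; rewrite -E' => -[].
  + by have : (A `&` B) x by []; rewrite E' => -[].
Qed.

(** A walk that visits all ends of the finite set [bd A] must be separated by
    every bond crossing [A]; thus these bonds all contain one of finitely many
    edges. *)
Lemma finite_bonds_crossing o k A : A `<=` component o -> finite_set (bd A) ->
  finite_set [set B | [/\ bond o B, ncard (bd B) <= k & ~ nested o A B]].
Proof.
move=> AH fA.
have fV : finite_set (\bigcup_(e in bd A) e).
  apply: bigcup_finite => // e /bdP[x [y [_ _ _ ->]]].
  by rewrite finite_setU; split; exact: finite_set1.
have [l lE] := (finite_seqP _).1 fV.
have lH : [set` l] `<=` component o.
  rewrite -lE => v [e /bdP[x [y [xy Ax _ ->]]] []] ->; first exact: AH.
  by rewrite -(component_adjE _ xy); apply: AH.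
have [p pp lp] := walk_through lH.
apply: (@sub_finite_set _ _ (\bigcup_(e in [set` pairmap (fun u v : G => [set u; v]) o p])
  [set B | [/\ bond o B, bd B e & ncard (bd B) <= k]])); last first.
  by apply: bigcup_finite => [|e _]; [exact: finite_seq | exact: finite_bonds_at].
move=> B [bB le nn]; apply: contrapT => N; apply: nn.
have side v : v \in o :: p -> B v <-> B o.
  by apply: walk_one_side => // e ep Be; apply: N; exists e.
have endp x y : adj x y -> bd A [set x; y] -> x \in o :: p.
  by move=> xy xyA; apply: lp; have : [set` l] x by rewrite -lE; exists [set x; y] => //; left.
have [Bo|nBo] := pselect (B o); last first.
  by apply: bond_off_ends => // x y xy /(endp _ _ xy) /side ->.
have BH : B `<=` component o by case: bB.
have -> : B = component o `\` (component o `\` B) by rewrite setDD setIidr.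
apply: nestedC => //; apply: bond_off_ends => //; first exact: bondC.
by move=> x y xy /(endp _ _ xy) /side E [_]; apply; rewrite E.
Qed.

End Bonds.

(** * Bridges *)

Lemma set2_eq (T : Type) (a b c d : T) : [set a; b] = [set c; d] ->
  (a = c /\ b = d) \/ (a = d /\ b = c).
Proof.
move=> E.
have : [set c; d] a by rewrite -E; left.
have : [set c; d] b by rewrite -E; right.
have : [set a; b] c by rewrite E; left.
have : [set a; b] d by rewrite E; right.
by move=> [->|->] [->|->] [?|?] [?|?]; subst; auto.
Qed.

Section IteratedBijection.
Context (T : Type) (h g : T -> T) (hg : cancel h g) (gh : cancel g h).
Import GRing.Theory.
Local Open Scope ring_scope.

Definition zpow (i : int) (v : T) : T :=
  match i with Posz n => iter n h v | Negz n => iter n.+1 g v end.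

Lemma zpowS i v : zpow (i + 1) v = h (zpow i v).
Proof.
case: i => [n|[|n]].
- by rewrite -PoszD addn1.
- by rewrite /= gh.
- rewrite (_ : Negz n.+1 + 1 = Negz n) /=; last by lia.
  by rewrite gh.
Qed.

Lemma zpowP i v : zpow (i - 1) v = g (zpow i v).
Proof. by rewrite -[in RHS](subrK 1 i) zpowS hg. Qed.

Lemma zpowD i j v : zpow (i + j) v = zpow i (zpow j v).
Proof.
elim/int_rect: i => [|n IH|n IH]; first by rewrite add0r.
- by rewrite -addn1 PoszD addrAC !zpowS IH.
- by rewrite -addn1 PoszD opprD addrAC !zpowP IH.
Qed.

Lemma zpowK i : cancel (zpow i) (zpow (- i)).
Proof. by move=> v; rewrite -zpowD addNr. Qed.

End IteratedBijection.

Section Bridges.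
Context {G : graph}.
Implicit Types (x y z u v : G) (D : set G).

Definition bridge x y : Prop := adj x y /\ @cut_space G [set [set x; y]].

(** The side of a bridge [xy] that contains [x], described by its only exit. *)
Lemma bridge_side x y : bridge x y ->
  exists D, [/\ D `<=` component x, D x, ~ D y &
                forall u v, D u -> ~ D v -> adj u v -> u = x /\ v = y].
Proof.
move=> [xy /cut_spaceP[A _ E]].
have N : ~ (A x <-> A y) by apply/(bd_adj _ xy); rewrite -E.
have key u v : adj u v -> ~ (A u <-> A v) -> (u = x /\ v = y) \/ (u = y /\ v = x).
  by move=> uv M; apply: set2_eq; have : bd A [set u; v] by [apply/(bd_adj _ uv)]; rewrite -E.
have Hx := component_refl x.
have Hy := component_adj xy Hx.
have [Ax|nAx] := pselect (A x).
  exists (A `&` component x); split=> [? []//|//|[]|u v [Au Hu] Nv uv]; first by tauto.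
  have Hv := component_adj uv Hu.
  have nAv : ~ A v by move=> ?; apply: Nv.
  have [|//|[uy _]] := key u v uv; first by tauto.
  by subst u; tauto.
have Ay : A y by apply: contrapT => ?; tauto.
exists (component x `\` A); split=> [? []//|//|[]//|u v [Hu Au] Nv uv].
have Hv := component_adj uv Hu.
have Av : A v by apply: contrapT => ?; apply: Nv.
have [|//|[uy _]] := key u v uv; first by tauto.
by subst u.
Qed.

Lemma bridge_act (f : G -> G) x y : Aut f -> bridge x y -> bridge (f x) (f y).
Proof.
move=> fA [xy c]; split; first by rewrite fA.2.
have [_ _ /(_ f _ fA c)] := cut_space_module G.
by rewrite /act image_set1 Defs.image2.
Qed.

Lemma bridge_sym x y : bridge x y -> bridge y x.
Proof. by move=> [xy c]; split; rewrite 1?adj_sym // setUC. Qed.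

Lemma closed_component (P : G -> Prop) s x :
  (forall u v, P u -> adj u v -> P v) -> P s -> component s x -> P x.
Proof. by move=> st Ps; move: x; apply: component_ind => // u v _; apply: st. Qed.

Import GRing.Theory.
Local Open Scope ring_scope.

(** When [h] maps [y] to [z] without fixing [x], the bridges [xy] and [xz] and
    their images under the powers of [h] form a two-way infinite path
      ..., h^-1 x, y, x, z, h x, ...
    along which [h] acts as a translation by two steps. The reflection of this
    path at [x] extends to the graph: the part hanging off the path at its
    [n]-th vertex is mapped by the power [h ^ (- n)] to the part hanging off
    the vertex with number [- n]. *)
Lemma bridge_reflection x y z (h : G -> G) :
  bridge x y -> bridge x z -> y <> z -> Aut h -> h y = z -> h x <> x ->
  exists f, [/\ Aut f, f x = x & f y = z].
Proof.
move=> bxy bxz yz hA hyz hx.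
have [g [gA hg gh]] := Aut_inv hA.
have gz : g z = y by rewrite -hyz hg.
have [D [DH Dx nDy eD]] := bridge_side bxy.
have [D' [D'H D'z nD'x eD']] := bridge_side (bridge_sym bxz).
have Hxz : component x = component z.
  by rewrite (@component_eq _ x z) //; apply: component_adj bxz.1 (component_refl x).
have Dz : D z.
  by apply: contrapT => nDz; have [_ zy] := eD _ _ Dx nDz bxz.1; apply: yz.
have D'D s : D' s -> D s.
  move=> D's; apply: contrapT => nDs.
  have [//] : (fun s => D' s /\ ~ D s) x.
  apply: (@closed_component (fun s => D' s /\ ~ D s) s) => //; last first.
    by rewrite (component_eq (D'H _ D's)) -Hxz; exact: component_refl.
  move=> u v [D'u nDu] uv; apply: contrapT => N.
  have [D'v|nD'v] := pselect (D' v).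
    have Dv : D v by apply: contrapT => ?; apply: N.
    rewrite adj_sym in uv; have [vx _] := eD _ _ Dv nDu uv.
    by apply: nD'x; rewrite -vx.
  by have [uz _] := eD' _ _ D'u nD'v uv; apply: nDu; rewrite uz.
have ehD u v : D (g u) -> ~ D (g v) -> adj u v -> u = h x /\ v = z.
  move=> Du nDv uv; have [|gu gv] := eD _ _ Du nDv; first by rewrite gA.2.
  by rewrite -[u]gh -[v]gh gu gv.
have hDD' s : D (g s) -> D' s.
  move=> Ds; apply: contrapT => nDs.
  have [] // : (fun s => D (g s) /\ ~ D' s) z.
  have sz : component s z.
    rewrite -[s]gh -hyz -image_component_Aut //; exists y => //.
    by rewrite (component_eq (DH _ Ds)); exact: component_adj bxy.1 (component_refl x).
  apply: (@closed_component (fun s => D (g s) /\ ~ D' s) s) => // u v [Du nD'u] uv.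
  apply: contrapT => N; have [Dv|nDv] := pselect (D (g v)).
    have D'v : D' v by apply: contrapT => ?; apply: N.
    rewrite adj_sym in uv; have [vz ux] := eD' _ _ D'v nD'u uv.
    by apply: nDy; rewrite -gz -vz.
  have [uhx vz] := ehD _ _ Du nDv uv.
  rewrite adj_sym in uv; have [|_ ux] := eD' v u _ nD'u uv; first by rewrite vz.
  by apply: hx; rewrite -uhx.
(* [W] is a fundamental domain for the powers of [h]: the sides [D], [D'] and
   [h D] of three consecutive bridges of the path form a decreasing chain. *)
pose W a := D a /\ ~ D (g a).
have Wx : W x by split=> // /hDD'.
have Wz : W z by split=> //; rewrite gz.
pose p := zpow h g.
have pS i v : p (i + 1) v = h (p i v) by apply: zpowS.
have pP i v : p (i - 1) v = g (p i v) by apply: zpowP.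
have pD i j v : p (i + j) v = p i (p j v) by apply: zpowD.
have p1 v : p 1 v = h v by rewrite -[1]add0r pS.
have pN1 v : p (- 1) v = g v by rewrite -[- 1]add0r pP.
have Hxy : component x = component y.
  by rewrite (@component_eq _ x y) //; apply: component_adj bxy.1 (component_refl x).
have pH i v : component x v -> component x (p i v).
  elim/int_rect: i => [//|n IH|n IH] /IH Hp.
    by rewrite -addn1 PoszD pS Hxz -hyz -image_component_Aut // -Hxy; exists (p n v).
  rewrite -addn1 PoszD opprD pP Hxy -gz -image_component_Aut // -Hxz.
  by exists (p (- n%:Z) v).
have p_adj i u v : adj (p i u) (p i v) = adj u v.
  elim/int_rect: i => [//|n IH|n IH].
    by rewrite -addn1 PoszD !pS hA.2.
  by rewrite -addn1 PoszD opprD !pP gA.2.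
have below n a : D a -> D (g (p (Posz n + 1) a)).
  move=> Da; elim: n => [|n IH]; first by rewrite pS hg.
  by rewrite pS hg intS addrC; apply/D'D/hDD'.
have uniq_lt (i j : int) a b : W a -> W b -> i < j -> p i a <> p j b.
  move=> [_ nDa] [Db _] ij E; apply: nDa.
  have [n nE] : exists n : nat, j - i = Posz n + 1 by exists `|(j - i - 1)%R|%N; lia.
  rewrite -[a]/(p 0 a) -(addNr i) pD E -pD addrC nE.
  exact: below.
have uniq_ (i j : int) a b : W a -> W b -> p i a = p j b -> i = j /\ a = b.
  move=> Wa Wb E; have ij : i = j.
    have [|[|//]] : i < j \/ j < i \/ i = j by lia.
      by move/(uniq_lt _ _ _ _ Wa Wb).
    by move/(uniq_lt _ _ _ _ Wb Wa); rewrite E.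
  by split=> //; rewrite -[a](zpowK hg gh i) -[b](zpowK hg gh j) -/p E ij.
have cover v : component x v -> exists i a, W a /\ v = p i a.
  move: v; apply: component_ind => [|u v _ [i [a [[Da nDa] ->]]] uv]; first by exists 0, x.
  pose b := p (- i) v.
  have vE : v = p i b by rewrite /b -pD subrr.
  have ab : adj a b by rewrite -(p_adj i) -vE.
  have [Db|nDb] := pselect (D b); last first.
    have [_ by_] := eD _ _ Da nDb ab.
    by exists (i - 1), z; rewrite vE by_ -gz pD pN1.
  have [Dgb|nDgb] := pselect (D (g b)); last by exists i, b.
  rewrite adj_sym in ab; have [bx _] := ehD _ _ Dgb nDa ab.
  by exists (i + 1), x; rewrite vE bx pD p1.
(* A point of [W] is at position 0 or 1 of the path according to [D'], so
   that [h ^ i] puts it at position [2 i] or [2 i + 1]; the reflection negates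
   this position. *)
pose s i a : int := if `[< D' a >] then - i - 1 else - i.
have sK a : involutive (s^~ a) by move=> i; rewrite /s; case: `[< D' a >] => /=; lia.
have [f [fp fo]] : exists f : G -> G, (forall i a, W a -> f (p i a) = p (s i a) a) /\
    (forall v, ~ component x v -> f v = v).
  pose Q v (t : G) := (forall i a, W a -> v = p i a -> t = p (s i a) a) /\
    (~ component x v -> t = v).
  have ex v : exists t, Q v t.
    have [Hv|nHv] := pselect (component x v); last first.
      exists v; split=> // i a Wa E; case: nHv.
      by rewrite E; apply/pH/DH; case: Wa.
    have [i [a [Wa E]]] := cover v Hv; exists (p (s i a) a); split=> // j b Wb.
    by rewrite E => /(uniq_ _ _ _ _ Wa Wb) [-> ->].
  have [f fQ] := choice ex; exists f; split=> [i a Wa|v nHv].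
    by case: (fQ (p i a)) => /(_ _ _ Wa erefl).
  by case: (fQ v) => _; apply.
have fx : f x = x by rewrite -[x in f x]/(p 0 x) fp // /s asboolF.
have fy : f y = z.
  have -> : y = p (- 1) z by rewrite pN1.
  by rewrite fp // /s asboolT.
have ff v : f (f v) = v.
  have [Hv|nHv] := pselect (component x v); last by rewrite !fo // fo.
  by have [i [a [Wa ->]]] := cover v Hv; rewrite !fp // [s _ a]sK.
have cross i a j b : W a -> W b -> i < j -> adj (p i a) (p j b) ->
    [/\ j = i + 1, a = z & b = x].
  move=> Wa Wb ij; have [n nE] : exists n : nat, j - i = Posz n + 1.
    by exists `|(j - i - 1)%R|%N; lia.
  have -> : j = i + (Posz n + 1) by lia.
  rewrite pD p_adj adj_sym => ab.
  have [E az] := ehD _ _ (below n b Wb.1) Wa.2 ab.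
  have [] := uniq_ (Posz n + 1) 1 b x Wb Wx; first by rewrite E p1.
  by move=> n0 bx; split=> //; lia.
have same a b : W a -> W b -> adj a b -> D' a -> ~ D' b -> a = z /\ b = x.
  by move=> _ _ ab D'a nD'b; exact: eD'.
have fadj u v : adj u v -> adj (f u) (f v).
  move=> uv; have [Hu|nHu] := pselect (component x u); last first.
    by rewrite !fo // -(component_adjE _ uv).
  have Hv := component_adj uv Hu.
  have [i [a [Wa uE]]] := cover u Hu; have [j [b [Wb vE]]] := cover v Hv.
  have sz i' : s i' z = - i' - 1 by rewrite /s asboolT.
  have sx i' : s i' x = - i' by rewrite /s asboolF.
  have zx i' : adj (p (i' - 1) z) (p i' x).
    by rewrite pD p_adj pN1 gz adj_sym; exact: bxy.1.
  have xz i' : adj (p i' x) (p i' z) by rewrite p_adj; exact: bxz.1.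
  move: uv; rewrite {}uE {}vE !fp //.
  have [ij|[ij|->]] : i < j \/ j < i \/ i = j by lia.
  - move=> /(cross _ _ _ _ Wa Wb ij) [-> -> ->]; rewrite sz sx opprD adj_sym.
    exact: xz.
  - rewrite adj_sym => /(cross _ _ _ _ Wb Wa ij) [-> -> ->]; rewrite sz sx opprD.
    exact: xz.
  rewrite p_adj => ab.
  have [D'a|nD'a] := pselect (D' a); have [D'b|nD'b] := pselect (D' b).
  - by rewrite /s !asboolT // p_adj.
  - by have [-> ->] := same _ _ Wa Wb ab D'a nD'b; rewrite sz sx; exact: zx.
  - rewrite adj_sym in ab; have [-> ->] := same _ _ Wb Wa ab D'b nD'a.
    by rewrite sz sx adj_sym; exact: zx.
  - by rewrite /s !asboolF // p_adj.
exists f; split=> //; split; first by exists f.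
by move=> u v; apply/idP/idP => [/fadj|/fadj //]; rewrite !ff.
Qed.

(** After moving [x] to [x'], there remain two bridges at the same vertex. An
    automorphism between their other ends either fixes this vertex, or gives
    rise to a reflection that does. *)
Lemma bridges_transitive : transitive_graph G ->
  forall x y x' y', bridge x y -> bridge x' y' ->
  exists f, [/\ Aut f, f x = x' & f y = y'].
Proof.
move=> tr x y x' y' b b'.
have [g gA gx] := tr x x'.
have bg := bridge_act gA b; rewrite gx in bg.
suff [f [fA fx fy]] : exists f, [/\ Aut f, f x' = x' & f (g y) = y'].
  by exists (f \o g); split; [exact: Aut_comp | rewrite /= gx | ].
have [E|ne] := pselect (g y = y').
  by exists id; split=> //; exact: Aut_id.
have [h hA hy] := tr (g y) y'.
have [hx|hx] := pselect (h x' = x'); first by exists h.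
exact: bridge_reflection hx.
Qed.

End Bridges.

(** * Bounding nested families of bonds *)

Lemma argmin_nat (T : Type) (S : set T) (mu : T -> nat) : S !=set0 ->
  exists2 x, S x & forall y, S y -> mu x <= mu y.
Proof.
move=> [x0 Sx0].
have ex : exists n, `[< exists2 x, S x & mu x = n >].
  by exists (mu x0); apply/asboolP; exists x0.
case: (ex_minnP ex) => n /asboolP[x Sx <-] le; exists x => // y Sy.
by apply: le; apply/asboolP; exists y.
Qed.

(** The member with the fewest members above it is maximal. *)
Lemma maximal_member (T : choiceType) (S : set (set T)) : finite_set S -> S !=set0 ->
  exists2 B, S B & forall B', S B' -> B `<=` B' -> B' = B.
Proof.
move=> fS /(argmin_nat (fun B => ncard [set B' | S B' /\ B `<=` B']))[B SB le].
exists B => // B' SB' BB'; apply: contrapT => ne; have := le _ SB'.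
rewrite leqNgt => /negP; apply; apply: (@ncard_lt _ _ _ B).
- by apply: sub_finite_set fS => C [].
- by move=> C [SC B'C]; split=> //; apply: subset_trans B'C.
- by split.
- by move=> [_ B'B]; apply: ne; apply/seteqP.
Qed.

Section Kneser.
Context {G : graph}.
Implicit Types (A B : set G) (E : set (set G)) (F : edgeset G) (o x y : G).

Lemma walk_parity_setY F F' x p : walk_parity (F `+` F') x p = walk_parity F x p (+) walk_parity F' x p.
Proof.
elim: p x => //= y p IH x; rewrite IH addbACA; congr (_ (+) _).
case: (asboolP (F _)) => H; case: (asboolP (F' _)) => H' /=;
  [apply: asboolF|apply: asboolT|apply: asboolT|apply: asboolF];
  rewrite /setY /setU /setD /=; tauto.
Qed.

Lemma cycle_parity_setY F F' c : cycle_parity (F `+` F') c = cycle_parity F c (+) cycle_parity F' c.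
Proof. by case: c => // x p; exact: walk_parity_setY. Qed.

Lemma cycle_parity_exists F c : is_cycle c -> cycle_parity F c ->
  exists u v, [/\ u \in c, v \in c, adj u v & F [set u; v]].
Proof.
case: c => // x p [_ _ cp] /walk_parity_exists /(_ cp) [u [v [uc vc uv Fuv]]].
have mem w : (w \in x :: rcons p x) = (w \in x :: p).
  by rewrite !inE mem_rcons inE; case: eqP.
by exists u, v; rewrite -!mem.
Qed.

(** Being a least member, [A] is determined by the triple. *)
Definition least E A x y y' : Prop :=
  [/\ E A, ~ A x, A y /\ A y' &
      forall A', E A' -> ~ A' x -> A' y -> A' y' -> A `<=` A'].

Definition nested_bonds o k E : Prop :=
  (forall A, E A -> bond o A /\ ncard (bd A) <= k) /\
  (forall A B, E A -> E B -> nested o A B).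

(** If an edge [xy] enters [A] at a vertex [y] that lies in no smaller member of
    [E], then [A] is the least member for [x], [y], [y]. Otherwise take a
    maximal member [B] below [A] and the set of edges [F] that [A] and [B] have
    in common. Since [A] is a bond different from [B], the set [F] is not a
    cut, and a generating cycle meets it oddly. The cycle meets [bd A] evenly,
    so it enters [A] also outside [B]: it has vertices [y] in [B] and [y'] in
    [A] outside [B], which no member of [E] properly below [A] contains
    together. *)
Lemma least_branching (cs : seq (seq G)) :
  (forall c, c \in cs -> is_cycle c) ->
  (forall F, finite_set F ->
    (forall c f, c \in cs -> Aut f -> cycle_parity F (map f c) = false) ->
    forall c, is_cycle c -> cycle_parity F c = false) ->
  forall o k E A, nested_bonds o k E -> E A ->
  exists x y y', [/\ component o x, least E A x y y' &
    (bridge x y /\ y' = y) \/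
    (exists c f, [/\ c \in cs, Aut f & [/\ x \in map f c, y \in map f c & y' \in map f c]])].
Proof.
move=> csc csg o k E A [Eb En] EA.
have EH B : E B -> B `<=` component o by move=> /Eb[[]].
have below A' x y : E A' -> component o x -> ~ A x -> ~ A' x -> A y -> A' y ->
    A `<=` A' \/ (A' `<=` A /\ A' <> A).
  move=> EA' xH nAx nA'x Ay A'y.
  case: (En _ _ EA EA') => H.
  - by case: (H _ Ay A'y).
  - by left.
  - have [->|ne] := pselect (A' = A); first by left.
    by right.
  - by case: (H _ xH).
have AH := EH _ EA.
have ends x y : adj x y -> A y -> component o x.
  by move=> xy /AH Hy; rewrite (component_adjE _ xy).
pose proper B := [/\ E B, B `<=` A & B <> A].
have [[x [y [xy nAx Ay core]]]|N] := pselect (exists x y,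
    [/\ adj x y, ~ A x, A y & forall B, proper B -> ~ B y]).
  exists x, y, y; split; first exact: ends Ay.
    split=> // A' EA' nA'x A'y _.
    have [//|[sub ne]] := below A' x y EA' (ends _ _ xy Ay) nAx nA'x Ay A'y.
    by case: (core A').
  have [[c [f [cc fA od]]]|even] := pselect (exists c f,
      [/\ c \in cs, Aut f & cycle_parity [set [set x; y]] (map f c)]).
    right; exists c, f; split=> //.
    have [u [v [uc vc uv /= Euv]]] := cycle_parity_exists (is_cycle_map fA (csc _ cc)) od.
    by case: (set2_eq Euv) => -[<- <-].
  left; split=> //; split=> //.
  have [|||C CH FC] := @even_is_cut _ o [set [set x; y]].
  - by move=> _ ->; exists x, y.
  - move=> u v uvE; case: (set2_eq uvE) => -[-> _]; first exact: ends Ay.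
    exact: AH.
  - apply: csg; first exact: finite_set1.
    by move=> c f cc fA; case od: (cycle_parity _ _) => //; case: even; exists c, f.
  by rewrite FC; apply: cut_space_bd; rewrite -FC; exact: finite_set1.
have [_ fA [e /[dup] Ae /bdP[y [x [yx Ay nAx eE]]]] mA] := (Eb _ EA).1.
have xy : adj x y by rewrite adj_sym.
have bad : exists B, [/\ E B, B `<=` A, B <> A & B y].
  apply: contrapT => M; apply: N; exists x, y; split=> // B [EB BA ne] By.
  by apply: M; exists B.
have [B [EB BA BnA By] Bmax] : exists2 B, [/\ E B, B `<=` A, B <> A & B y] &
    forall B', [/\ E B', B' `<=` A, B' <> A & B' y] -> B `<=` B' -> B' = B.
  apply: maximal_member => //.
  apply: (sub_finite_set _ (finite_bonds_at o k [set x; y])).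
  move=> B [/Eb[bB le] BA _ By]; split=> //; apply/(bd_adj _ xy).
  by have := BA x; tauto.
have xH := ends _ _ xy Ay.
have disj B' z : proper B' -> B z -> B' z -> B' `<=` B.
  move=> [EB' B'A ne] Bz B'z; case: (En _ _ EB EB') => H //.
  - by case: (H z).
  - by rewrite (Bmax B') //; split=> //; apply: H.
  - by case: (H x xH) => [/BA|/B'A].
pose F := bd A `&` bd B.
have FA : F `<=` bd A by move=> f [].
have fF : finite_set F by apply: sub_finite_set fA.
have Fne : F [set x; y].
  by split; apply/(bd_adj _ xy); [tauto | have := BA x; tauto].
have [[c [f [cc fAut od]]]|even] := pselect (exists c f,
    [/\ c \in cs, Aut f & cycle_parity F (map f c)]); last first.
  have [|||C CH FC] := @even_is_cut _ o F.
  - by move=> f /FA /bd_edges.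
  - move=> u v /FA /bdP[u' [v' [uv Au' _ uvE]]]; case: (set2_eq uvE) => -[-> _].
      exact: AH.
    by rewrite -(component_adjE _ uv); exact: AH.
  - apply: csg => // c f cc fAut; case od: (cycle_parity _ _) => //.
    by case: even; exists c, f.
  exfalso; have AB : bd A = bd B.
    have [|C0|FAe] := mA C; first by rewrite -FC.
      by move: Fne; rewrite FC C0.
    have [_ _ _ mB] := (Eb _ EB).1; have [|C0|//] := mB A.
      by rewrite -FAe -FC => f [].
    by move: Ae; rewrite C0.
  have [E0|E0] := bd_inj_component AH (EH _ EB) AB; first by apply: BnA.
  by have := BA _ By; rewrite E0 => -[_].
have ccf := is_cycle_map fAut (csc _ cc).
have wlog_adj (P : G -> G -> Prop) : (forall u v, P u v -> P v u) ->
    forall X, (exists u v, [/\ u \in map f c, v \in map f c, adj u v & P u v]) ->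
    (forall u v, adj u v -> P u v -> ~ (X u <-> X v)) ->
    exists u v, [/\ u \in map f c, v \in map f c, adj u v & [/\ P u v, ~ X u & X v]].
  move=> Psym X [u [v [uc vc uv Puv]]] nX.
  have N' := nX _ _ uv Puv; have [Xu|nXu] := pselect (X u).
    by exists v, u; rewrite adj_sym; split=> //; split=> //; [exact: Psym | tauto].
  by exists u, v; split=> //; split=> //; apply: contrapT => ?; tauto.
have [u [v [uc vc uv [Fuv nAu Av]]]] := wlog_adj (fun u v => F [set u; v])
  (fun u v H => eq_ind _ F H _ (setUC _ _)) A (cycle_parity_exists ccf od)
  (fun u v uv H => (bd_adj A uv).1 H.1).
have od' : cycle_parity (bd A `\` bd B) (map f c).
  have := cycle_parity_bd A ccf.
  rewrite {1}(_ : bd A = F `+` (bd A `\` bd B)).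
    by rewrite cycle_parity_setY od addTb => /negbFE.
  apply/seteqP; split=> h; rewrite /F /setY /setI /setU /setD /=;
    by have [] := pselect (bd A h); have [] := pselect (bd B h); tauto.
have [u' [v' [_ vc' uv' [[_ nB] nAu' Av']]]] := wlog_adj
  (fun u v => (bd A `\` bd B) [set u; v])
  (fun u v H => eq_ind _ (bd A `\` bd B) H _ (setUC _ _)) A (cycle_parity_exists ccf od')
  (fun u v uv H => (bd_adj A uv).1 H.1).
have nBv' : ~ B v'.
  move=> Bv'; apply: nB; apply/(bd_adj _ uv'); have := BA u'; tauto.
have Bv : B v.
  have [_ /(bd_adj _ uv)] := Fuv; have := BA u; have := pselect (B v); tauto.
exists u, v, v'; split; first exact: ends Av.
- split=> // A' EA' nA'u A'v A'v'.
  have [//|[sub ne]] := below A' u v EA' (ends _ _ uv Av) nAu nA'u Av A'v.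
  by case: nBv'; apply: (disj A' v).
- by right; exists c, f.
Qed.

(** Up to automorphisms there are only finitely many triples of vertices on
    generating cycles and, by [bridges_transitive], one bridge. *)
Lemma finitely_many_branchings : transitive_graph G ->
  finitely_generated (@cycle_space G) ->
  exists R : seq (G * G * G), forall o k E A, nested_bonds o k E -> E A ->
    exists2 r, r \in R & exists f,
      [/\ Aut f, component o (f r.1.1) & least E A (f r.1.1) (f r.1.2) (f r.2)].
Proof.
move=> tr fg; have [cs csc csg] := cycle_representatives fg.
pose R0 := flatten [seq [seq (p, w) | p <- [seq (u, v) | u <- c, v <- c], w <- c] | c <- cs].
have [R1 R1P] : exists R1 : seq (G * G * G), forall x y, bridge x y ->
    exists2 r, r \in R1 & exists f, [/\ Aut f, f r.1.1 = x, f r.1.2 = y & f r.2 = y].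
  have [[x0 [y0 b0]]|N] := pselect (exists x y, bridge x y); last first.
    by exists [::] => x y b; case: N; exists x, y.
  exists [:: (x0, y0, y0)] => x y b; exists (x0, y0, y0); first by rewrite inE.
  by have [f [fA fx fy]] := bridges_transitive tr b0 b; exists f.
exists (R0 ++ R1) => o k E A nE EA.
have [x [y [y' [xH le [[b yy]|[c [f [cc fA]]]]]]]] := least_branching csc csg nE EA.
  have [r rR [f [fA fx fy fz]]] := R1P _ _ b.
  exists r; first by rewrite mem_cat rR orbT.
  by exists f; rewrite fx fy fz; split=> //; rewrite -{2}yy.
move=> [/mapP[u uc xE] /mapP[v vc yE] /mapP[w wc y'E]]; subst.
exists (u, v, w); last by exists f.
rewrite mem_cat; apply/orP; left; apply/flattenP.
exists [seq (p, w) | p <- [seq (u, v) | u <- c, v <- c], w <- c]; first exact: map_f.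
by apply: allpairs_f => //; apply: allpairs_f.
Qed.
End Kneser.

(** * Systems of nested bonds *)

(** In the application, [N a b] and [J a b] say that the corner of [A] and [B] given by the signs
    [a] and [b] is not generated, respectively has a large boundary. *)
Lemma opposite_corners (N J : bool -> bool -> Prop) :
  (forall a, exists b, N a b) -> (forall b, exists a, J a b) ->
  (forall a b, N a b -> J a b) -> exists a b, N a b /\ J (~~ a) (~~ b).
Proof.
move=> hN hJ NJ; have [b1 n1] := hN true; have [b2 n2] := hN false.
have [e|e] := eqVneq b1 b2; last first.
  exists true, b1; split=> //; apply: NJ; move: n2 e => /=.
  by case: b1 {n1}; case: b2.
subst b2; have [[] j] := hJ (~~ b1).
  by exists false, b1.
by exists true, b1.
Qed.

Section Extension.
Context {G : graph}.
Implicit Types (A B D X Y : set G) (E : set (set G)) (F : edgeset G) (o x y : G).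
Implicit Types (s : seq (set G)).

Definition span_below n : set (edgeset G) := span [set F | cut_space F /\ ncard F < n].

Definition indecomposable A : Prop :=
  finite_set (bd A) /\ ~ span_below (ncard (bd A)) (bd A).

Lemma finite_cut F : cut_space F -> finite_set F.
Proof. by move=> /cut_spaceP[A fA ->]. Qed.

(** A nonempty cut properly contained in [bd A] would split it into two smaller
    cuts. *)
Lemma indecomposable_bond o A : A `<=` component o -> indecomposable A -> bond o A.
Proof.
move=> AH [fA nA]; split=> //.
  by apply: contrapT => /nonemptyPn E; apply: nA; rewrite E; exact: span0.
move=> B BA; apply: contrapT => N; apply: nA.
have [nB nBA] : bd B <> set0 /\ bd B <> bd A by split=> E; apply: N; [left|right].
have fB := sub_finite_set BA fA.
have E : bd A `+` bd B = bd A `\` bd B.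
  apply/seteqP; split=> e; rewrite /setY /setU /setD /=; have := BA e; tauto.
have fD : finite_set (bd A `\` bd B) by exact: finite_setD.
have EA : bd B `+` (bd A `+` bd B) = bd A.
  by rewrite setYC -setYA setYK setY0.
rewrite -[X in span_below _ X]EA.
have [e Be] : bd B !=set0 by apply: contrapT => /nonemptyPn.
apply: span_add; apply: span_gen; split.
- exact: cut_space_bd.
- have [e' [Ae' nBe']] : exists e', bd A e' /\ ~ bd B e'.
    apply: contrapT => M; apply: nBA; apply/seteqP; split=> // e' Ae'.
    by apply: contrapT => nBe'; apply: M; exists e'.
  exact: (ncard_lt fA BA Ae' nBe').
- by rewrite bdY; apply: cut_space_bd; rewrite -bdY E.
- by rewrite E; apply: (ncard_lt fA _ (BA _ Be)) => [e' []//|[]].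
Qed.

Lemma ncard_act (f : G -> G) F : Aut f -> finite_set F -> ncard (act f F) = ncard F.
Proof. by move=> fA fF; apply: ncard_image => //; apply/image_inj_fun/Aut_inj. Qed.

Lemma span_below_act n (f : G -> G) F : Aut f -> span_below n F -> span_below n (act f F).
Proof.
move=> fA; move: F; apply: span_min.
- by rewrite /= /act image_set0; exact: span0.
- by move=> F F' ? ?; rewrite /= act_setY; [exact: span_add | exact: Aut_inj].
move=> F [cF lF]; apply: span_gen; split.
  by have [_ _] := cut_space_module G; apply.
by rewrite ncard_act //; exact: finite_cut.
Qed.

Lemma ncard_bd_image (f : G -> G) A : Aut f -> finite_set (bd A) ->
  ncard (bd (f @` A)) = ncard (bd A).
Proof. by move=> fA fin; rewrite -act_bd // ncard_act. Qed.

Lemma image_cancel (f g : G -> G) A : cancel f g -> g @` (f @` A) = A.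
Proof.
move=> fg; rewrite image_comp; apply/seteqP; split=> [_ [x Ax <-]|x Ax].
  by rewrite /= fg.
by exists x => //=; rewrite fg.
Qed.

Lemma indecomposable_image (f : G -> G) A : Aut f -> indecomposable A ->
  indecomposable (f @` A).
Proof.
move=> fA [fin nA]; split; first by rewrite -act_bd //; exact: finite_image.
have [g [gA fg gf]] := Aut_inv fA.
move=> /(span_below_act gA); rewrite ncard_bd_image // act_bd // image_cancel //.
Qed.

(** The automorphisms mapping the component of [o] to itself. *)
Definition stab o (f : G -> G) : Prop := Aut f /\ component o (f o).

Lemma stab_image o f : stab o f -> f @` component o = component o.
Proof. by move=> [fA fo]; rewrite image_component_Aut // (component_eq fo). Qed.

Lemma stab_inv o f : stab o f -> exists g, [/\ stab o g, cancel f g & cancel g f].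
Proof.
move=> [fA fo]; have [g [gA fg gf]] := Aut_inv fA; exists g; split=> //; split=> //.
rewrite -{1}[o]fg -image_component_Aut //; exists o => //; exact: component_sym.
Qed.

Lemma stab_comp o f g : stab o f -> stab o g -> stab o (f \o g).
Proof.
move=> sf [gA go]; split; first by apply: Aut_comp => //; case: sf.
by rewrite -(stab_image sf); exists (g o).
Qed.

Lemma stab_id o : stab o id.
Proof. by split; [exact: Aut_id | exact: component_refl]. Qed.

Lemma sub_image_stab o f A : stab o f -> A `<=` component o -> f @` A `<=` component o.
Proof. by move=> sf AH; rewrite -(stab_image sf); apply: image_subset. Qed.

Lemma nested_image o f A B : stab o f -> nested o A B -> nested o (f @` A) (f @` B).
Proof.
move=> sf; have fI := Aut_inj sf.1.
case=> H; [apply: Or41|apply: Or42|apply: Or43|apply: Or44].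
- by move=> _ [x Ax <-] [y By /fI yx]; apply: (H x) => //; rewrite -yx.
- by move=> _ [x /H Bx <-]; exists x.
- by move=> _ [x /H Bx <-]; exists x.
- by rewrite -(stab_image sf) => _ [x /H[Ax|Bx] <-]; [left|right]; exists x.
Qed.

(** The two sides of a cut, indexed by signs, in order that the four corners of
    two sets can be treated alike. *)
Definition side o (a : bool) A : set G := if a then A else component o `\` A.

Lemma side_sub o a A : A `<=` component o -> side o a A `<=` component o.
Proof. by case: a => //= _ x []. Qed.

Lemma bd_side o a A : A `<=` component o -> bd (side o a A) = bd A.
Proof. by case: a => //= AH; exact: bd_componentD. Qed.

Lemma side_neg o a A : A `<=` component o -> component o `\` side o a A = side o (~~ a) A.
Proof. by case: a => //= AH; rewrite setDD setIidr. Qed.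

Lemma nested_side o a A B : A `<=` component o -> nested o A B -> nested o A (side o a B).
Proof. by case: a => //= AH; exact: nestedC. Qed.

Lemma nested_sideE o a A B : A `<=` component o -> B `<=` component o ->
  nested o A (side o a B) <-> nested o A B.
Proof.
move=> AH BH; split; last exact: nested_side.
by case: a => //= /(nestedC AH); rewrite setDD setIidr.
Qed.

Lemma finite_bdI A B : finite_set (bd A) -> finite_set (bd B) -> finite_set (bd (A `&` B)).
Proof.
move=> fA fB; apply: (@sub_finite_set _ _ (bd A `|` bd B)); last by rewrite finite_setU.
apply: (sub_edges (@bd_edges _ _)) => x y xy /(bd_adj _ xy) /= N.
apply: contrapT => M; apply: N.
have [//|nA] := pselect (A x <-> A y); last by case: M; left; apply/(bd_adj _ xy).
have [//|nB] := pselect (B x <-> B y); last by case: M; right; apply/(bd_adj _ xy).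
by rewrite /setI /=; tauto.
Qed.

Lemma bd_corners o A B : A `<=` component o ->
  bd (A `&` B) `+` bd (A `&` side o false B) = bd A.
Proof.
move=> AH; rewrite bdY; congr bd; apply/seteqP; split=> x; have := AH x;
  rewrite /setY /setU /setD /setI /=;
  by have [] := pselect (B x); tauto.
Qed.

Definition span_bd s : set (edgeset G) := span (Aut_orbits [set` map bd s]).

Definition translates o s : set (set G) :=
  [set B | exists A f, [/\ A \in s, stab o f & B = f @` A]].

Fixpoint inequivalent s : Prop :=
  if s is A :: s' then
    (forall B f, B \in s' -> Aut f -> f @` B <> A) /\ inequivalent s'
  else True.

(** The members of [s] represent the orbits of a nested invariant family that
    generates the cuts with fewer than [k] edges. A member [B] may have a
    coboundary smaller than [k]; its indecomposability ensures that on either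
    side of [B] every other set leaves a corner with at least as many edges as
    [bd B]. *)
Definition nested_system o k s : Prop :=
  [/\ forall A, A \in s -> [/\ A `<=` component o, indecomposable A & ncard (bd A) <= k],
      forall A B, translates o s A -> translates o s B -> nested o A B,
      inequivalent s &
      forall F, cut_space F -> ncard F < k -> span_bd s F].

Lemma translates_image o s f B : stab o f -> translates o s B -> translates o s (f @` B).
Proof.
move=> sf [A [g [As sg ->]]]; exists A, (f \o g); split=> //; first exact: stab_comp.
by rewrite image_comp.
Qed.

Lemma nested_system_bonds o k s : nested_system o k s -> nested_bonds o k (translates o s).
Proof.
move=> [ga gb _ _]; split=> // _ [A [f [/ga[AH iA le] sf ->]]].
split; last by rewrite ncard_bd_image //; [case: sf | case: iA].
apply: indecomposable_bond; first exact: sub_image_stab.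
by apply: indecomposable_image => //; case: sf.
Qed.

(** Two members charged to the same triple of [R] are, after translation, both
    the least member for one and the same triple, hence equivalent. *)
Lemma nested_system_size (R : seq (G * G * G)) o k s :
  (forall k E A, nested_bonds o k E -> E A ->
    exists2 r, r \in R & exists f,
      [/\ Aut f, component o (f r.1.1) & least E A (f r.1.1) (f r.1.2) (f r.2)]) ->
  nested_system o k s -> size s <= size R.
Proof.
move=> HR gs; pose P A r := exists f,
  [/\ Aut f, component o (f r.1.1) & least (translates o s) A (f r.1.1) (f r.1.2) (f r.2)].
have ex A : exists r, A \in s -> r \in R /\ P A r.
  have [As|nAs] := boolP (A \in s); last first.
    by exists (o, o, o).
  have [|r rR Pr] := HR k (translates o s) A (nested_system_bonds gs).
    by exists A, id; split=> //; [exact: stab_id | rewrite image_id].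
  by exists r.
have [phi phiP] := choice ex.
have inj A B : A \in s -> B \in s -> phi A = phi B -> exists2 f, Aut f & f @` B = A.
  move=> /phiP[_ [f [fA fo lA]]] /phiP[_ [g [gA go lB]]] E; rewrite E in fo lA.
  have [g' [g'A gg' g'g]] := Aut_inv gA.
  exists (f \o g'); first exact: Aut_comp.
  set r := phi B in fo lA go lB.
  have sfg : stab o (f \o g').
    split; first exact: Aut_comp.
    have : component (f (g' (g r.1.1))) (f (g' o)).
      rewrite -image_component_Aut //; exists (g' o) => //.
      by rewrite -image_component_Aut //; exists o => //; exact: component_sym.
    by rewrite gg' (component_eq fo).
  have [tA nA [A1 A2] mA] := lA; have [tB nB [B1 B2] mB] := lB.
  have fB : translates o s ((f \o g') @` B) by apply: translates_image.
  have sub1 : A `<=` (f \o g') @` B.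
    apply: mA => //; last 2 first.
    - by exists (g r.1.2) => //=; rewrite gg'.
    - by exists (g r.2) => //=; rewrite gg'.
    by move=> [x Bx /= /(Aut_inj fA) xE]; apply: nB; rewrite -xE g'g.
  have [h [sh fh hf]] := stab_inv sfg.
  have hg z : h (f z) = g z by rewrite -[in LHS](gg' z) -[f _]/((f \o g') _) fh.
  have sub2 : B `<=` h @` A.
    apply: mB; first exact: translates_image.
    - by move=> [x Ax /=]; rewrite -hg => /(Aut_inj sh.1) xE; apply: nA; rewrite -xE.
    - by exists (f r.1.2).
    - by exists (f r.2).
  apply/seteqP; split=> // _ [x /sub2[y Ay <-] <-].
  by rewrite hf.
have -> : size s = size (map phi s) by rewrite size_map.
have [_ _ ineq _] := gs.
apply: uniq_leq_size; last by move=> _ /mapP[A /phiP[rR _] ->].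
suff H t : inequivalent t -> {subset t <= s} -> uniq (map phi t) by exact: H.
elim: t => //= A t IH [nA it] sub; rewrite IH ?andbT //; last first.
  by move=> B Bt; apply: sub; rewrite inE Bt orbT.
apply/negP => /mapP[B Bt E].
have Bs : B \in s by apply: sub; rewrite inE Bt orbT.
have [f fA fB] := inj A B (sub _ (mem_head _ _)) Bs E.
exact: nA fB.
Qed.

End Extension.

(** * Enlarging a system of nested bonds *)

Section Final.
Context {G : graph}.
Implicit Types (A B D X Y : set G) (E : set (set G)) (F : edgeset G) (o x y : G).
Implicit Types (s : seq (set G)).

(** The part of a cut within one component and the remainder are both cuts, and
    the remainder is smaller, hence in [U]. By transitivity the component may
    be taken to be that of [o]. *)
Lemma cut_in_component o (U : set (edgeset G)) F : transitive_graph G -> is_Aut_module U ->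
  cut_space F -> ~ U F -> (forall F', cut_space F' -> ncard F' < ncard F -> U F') ->
  exists A, [/\ A `<=` component o, finite_set (bd A), ncard (bd A) <= ncard F & ~ U (bd A)].
Proof.
move=> tr [U0 UD UA] /cut_spaceP[A fA ->] nU Ulow.
have [e /bdP[x [y [xy Ax nAy _]]]] : bd A !=set0.
  by apply: contrapT => /nonemptyPn E; apply: nU; rewrite E.
have sub1 : bd (A `&` component x) `<=` bd A.
  apply: (sub_edges (@bd_edges _ _)) => u v uv /(bd_adj _ uv) /= N.
  by apply/(bd_adj _ uv); have := component_adjE x uv; tauto.
have E : bd (A `\` component x) `+` bd (A `&` component x) = bd A.
  rewrite bdY; congr bd; apply/seteqP; split=> u; rewrite /setY /setU /setD /setI /=;
  by have [] := pselect (component x u); tauto.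
have sub2 : bd (A `\` component x) `<=` bd A.
  apply: (sub_edges (@bd_edges _ _)) => u v uv /(bd_adj _ uv) /= N.
  by apply/(bd_adj _ uv); have := component_adjE x uv; tauto.
have U2 : U (bd (A `\` component x)).
  apply: Ulow; first by apply: cut_space_bd; apply: sub_finite_set fA.
  apply: (@ncard_lt _ _ _ [set x; y]) => //; first by apply/(bd_adj _ xy); tauto.
  move=> /(bd_adj _ xy); apply.
  have := component_refl x; have := component_adj xy (component_refl x); rewrite /setD /=; tauto.
have nU1 : ~ U (bd (A `&` component x)) by move=> U1; apply: nU; rewrite -E; exact: UD.
have [f fAut fx] := tr x o.
have fin1 : finite_set (bd (A `&` component x)) by apply: sub_finite_set fA.
exists (f @` (A `&` component x)); split.
- rewrite -fx -image_component_Aut //; apply: image_subset; exact: subIsetr.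
- by rewrite -act_bd //; exact: finite_image.
- by rewrite ncard_bd_image //; exact: ncard_le.
have [g [gA fg gf]] := Aut_inv fAut.
move=> /(UA _ _ gA); rewrite act_bd // image_cancel //.
Qed.

Lemma span_bd_module s : is_Aut_module (@span_bd G s).
Proof. exact: span_orbits_module. Qed.

(** Let [K] consist of the sides of the cuts with at most [k] edges that are not
    yet generated. If a member of [K] crosses [B], some corner of the two is again
    in [K]: the corners on each side of [A] add up to [bd A], those on each side
    of [B] add up to [bd B], so that a corner that is not generated lies
    opposite to one with at least as many edges as [bd B], and submodularity
    bounds its own size. As corners cross less, a member of [K] that crosses
    the fewest translates of [s] crosses none of them; and among the members
    that cross none, one that crosses the fewest of these is nested with its
    own translates. *)
Lemma nested_system_extend o k s : transitive_graph G -> nested_system o k s ->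
  (exists F, [/\ cut_space F, ncard F <= k & ~ span_bd s F]) ->
  exists A, nested_system o k (A :: s).
Proof.
move=> tr gs [F0 [cF0 lF0 nF0]].
have [ga gb gc gd] := gs.
have [U0 UD UA] := span_bd_module s.
set U := span_bd s in gd nF0 U0 UD UA *.
pose K := [set A | [/\ A `<=` component o, finite_set (bd A),
                       ncard (bd A) <= k & ~ U (bd A)]].
have big X : finite_set (bd X) -> ~ U (bd X) -> k <= ncard (bd X).
  move=> fX nX; rewrite leqNgt; apply/negP => lt; apply: nX.
  by apply: gd => //; exact: cut_space_bd.
have [A0 KA0] : K !=set0.
  have [||A [AH fA le nU]] := @cut_in_component o U F0 tr _ cF0 nF0; first by split.
    by move=> F' cF' lt; apply: gd => //; apply: leq_trans lt lF0.
  by exists A; split=> //; apply: leq_trans lF0.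
have Kside a A : K A -> K (side o a A).
  by move=> [AH fA le nA]; split; rewrite ?bd_side //; exact: side_sub.
have Kimage f A : stab o f -> K A -> K (f @` A).
  move=> sf [AH fA le nA]; have [fAut _] := sf; split.
  - exact: sub_image_stab.
  - by rewrite -act_bd //; exact: finite_image.
  - by rewrite ncard_bd_image.
  have [g [gA fg gf]] := Aut_inv fAut.
  by move=> /(UA _ _ gA); rewrite act_bd // image_cancel.
have Kindec A : K A -> indecomposable A.
  move=> [AH fA le nA]; split=> // sm; apply: nA; move: sm; apply: span_min => //.
  by move=> F [cF lF]; apply: gd => //; apply: leq_trans lF le.
have Kbond A : K A -> bond o A.
  by move=> KA; apply: indecomposable_bond; [case: KA | exact: Kindec].
pose Fam := translates o s.
have [Fb Fn] : nested_bonds o k Fam := nested_system_bonds gs.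
have FH B : Fam B -> B `<=` component o by move=> /Fb[[]].
have Kcorner A B (J : bool -> bool -> Prop) : K A -> B `<=` component o ->
    (forall b, exists a, J a b) ->
    (forall a b, ~ U (bd (side o a A `&` side o b B)) -> J a b) ->
    exists a b, ~ U (bd (side o a A `&` side o b B)) /\ J (~~ a) (~~ b).
  move=> KA BH hJ NJ; apply: opposite_corners hJ NJ => a.
  have [AaH _ _ nAa] := Kside a A KA.
  apply: contrapT => N; apply: nAa; rewrite -(bd_corners B AaH).
  by apply: UD; apply: contrapT => ?; apply: N; [exists true|exists false].
have submod a b A B : A `<=` component o -> B `<=` component o ->
    finite_set (bd A) -> finite_set (bd B) ->
    ncard (bd (side o a A `&` side o b B)) +
    ncard (bd (side o (~~ a) A `&` side o (~~ b) B)) <= ncard (bd A) + ncard (bd B).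
  move=> AH BH fA fB.
  have -> : bd (side o (~~ a) A `&` side o (~~ b) B) = bd (side o a A `|` side o b B).
    rewrite -!side_neg // -setDUr bd_componentD // => x [].
      exact: side_sub.
    exact: side_sub.
  by rewrite -(bd_side a AH) -(bd_side b BH); apply: submodular; rewrite bd_side.
have opp a b A B : A `<=` component o -> B `<=` component o -> ~ nested o A B ->
    exists z, (side o a A `&` side o b B) z.
  move=> AH BH nn; have [[u [? ?]] [v [? ?]] [w [? ?]] [z [? ? ?]]] := not_nestedP nn.
  case: a; case: b; [exists u|exists v|exists w|exists z] => //; split=> //; split=> //.
    exact: AH.
  exact: BH.
have opp' a b A B : A `<=` component o -> B `<=` component o -> ~ nested o A B ->
    exists z, [/\ component o z, ~ side o a A z & ~ side o b B z].
  move=> AH BH /(opp (~~ a) (~~ b) _ _ AH BH)[z].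
  by rewrite -!side_neg // => -[[? ?] [? ?]]; exists z.
pose cr E A := [set D | E D /\ ~ nested o A D].
have fin_cr E A : (forall D, E D -> bond o D /\ ncard (bd D) <= k) -> K A -> finite_set (cr E A).
  move=> hE [AH fA _ _]; apply: sub_finite_set (finite_bonds_crossing k AH fA).
  by move=> D [/hE[? ?] ?].
have cr_side E A a : (forall D, E D -> D `<=` component o) -> A `<=` component o ->
    cr E (side o a A) = cr E A.
  move=> EH AH; apply/seteqP; split=> D [ED nn]; split=> // /nested_sym nAD;
  apply: nn; apply/nested_sym.
    exact: nested_side (EH _ ED) nAD.
  by apply/(nested_sideE a) => //; exact: EH.
(* First choice: as few crossings with the family as possible. *)
have [A1 KA1 min1] := argmin_nat (fun A => ncard (cr Fam A)) (ex_intro _ _ KA0).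
have A1n B : Fam B -> nested o A1 B.
  move=> FB; apply: contrapT => nn.
  have [A1H fA1 leA1 nA1] := KA1; have BH := FH _ FB.
  have [BB leB] := Fb _ FB; have [_ fB _ _] := BB.
  have iB : indecomposable B.
    have [C [f [Cs [fA _] ->]]] := FB; apply: indecomposable_image => //.
    by have [] := ga _ Cs.
  have fcorner a b : finite_set (bd (side o a A1 `&` side o b B)).
    by apply: finite_bdI; rewrite bd_side.
  have [||a [b [nX JY]]] := @Kcorner A1 B
    (fun a b => ncard (bd B) <= ncard (bd (side o a A1 `&` side o b B)))
    KA1 BH.
  - move=> b; apply: contrapT => N; apply: iB.2.
    rewrite -[X in span_below _ X](bd_side b BH) -(bd_corners A1 (@side_sub _ o b B BH)).
    by apply: span_add; apply: span_gen; split; rewrite setIC;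
      [apply: cut_space_bd; exact: (fcorner true)
      |rewrite ltnNge; apply/negP => le; apply: N; exists true
      |apply: cut_space_bd; exact: (fcorner false)
      |rewrite ltnNge; apply/negP => le; apply: N; exists false].
  - by move=> a b /(big _ (fcorner a b)); apply: leq_trans.
  have KX : K (side o a A1 `&` side o b B).
    split=> //; first by move=> x [/side_sub-/(_ A1H)].
    have := submod a b _ _ A1H BH fA1 fB; move: JY leA1; lia.
  (* [B] crosses [A1] and no longer crosses the corner. *)
  have := min1 _ KX; rewrite leqNgt => /negP; apply.
  rewrite -(cr_side Fam A1 a) //; apply: (@ncard_lt _ _ _ B).
  - by apply: fin_cr => //; exact: Kside.
  - move=> D [FD nX']; split=> // nAD; apply: nX'; apply/nested_sym.
    apply: nested_corner; [exact: nested_sym | | exact: opp'].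
    by apply: nested_side; [exact: FH | exact: Fn].
  - by rewrite cr_side.
  - move=> [_]; apply; have : nested o (side o a A1 `&` side o b B) (side o b B).
      by apply: Or42 => x [].
    by apply: (nested_sideE _ _ _).1 => // x [/side_sub-/(_ A1H)].
(* Second choice: as few crossings as possible with other candidates that
   are nested with the family. *)
pose K0 := [set A | K A /\ forall B, Fam B -> nested o A B].
have K0b D : K0 D -> bond o D /\ ncard (bd D) <= k by move=> [KD _]; split; [exact: Kbond | case: KD].
have K0H D : K0 D -> D `<=` component o by move=> /K0b[[]].
have K0image f A : stab o f -> K0 A -> K0 (f @` A).
  move=> sf [KA nA]; split; first exact: Kimage.
  move=> B FB; have [g [sg fg gf]] := stab_inv sf.
  rewrite -(image_cancel B gf); apply: nested_image => //.
  by apply: nA; exact: translates_image.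
have [A K0A minA] := argmin_nat (fun A => ncard (cr K0 A))
  (ex_intro _ _ (conj KA1 A1n : K0 A1)).
have [KA nA] := K0A; have [AH fA leA nUA] := KA.
have self f : stab o f -> nested o A (f @` A).
  move=> sf; apply: contrapT => nn; set B := f @` A in nn.
  have K0B : K0 B by exact: K0image.
  have [KB nB] := K0B; have [BH fB leB nUB] := KB.
  have crB : ncard (cr K0 B) <= ncard (cr K0 A).
    have [g [sg fg gf]] := stab_inv sf.
    rewrite -(ncard_image (image_inj_fun (Aut_inj sf.1)) (fin_cr _ _ K0b KA)).
    apply: ncard_le; first by apply: finite_image; exact: fin_cr.
    move=> D [K0D nBD]; exists (g @` D); last exact: image_cancel.
    split; first exact: K0image.
    by move=> nAD; apply: nBD; rewrite -(image_cancel D gf); exact: nested_image.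
  have fcorner a b : finite_set (bd (side o a A `&` side o b B)).
    by apply: finite_bdI; rewrite bd_side.
  have [||a [b [nX nY]]] := @Kcorner A B (fun a b => ~ U (bd (side o a A `&` side o b B)))
    KA BH; [|by []|].
    move=> b; have [_ _ _ nBb] := Kside b B KB.
    apply: contrapT => N; apply: nBb; rewrite -(bd_corners A (@side_sub _ o b B BH)).
    by apply: UD; rewrite setIC; apply: contrapT => ?; apply: N; [exists true|exists false].
  have := submod a b _ _ AH BH fA fB.
  have := big _ (fcorner a b) nX; have := big _ (fcorner _ _) nY.
  set X := side o a A `&` _; set Y := side o (~~ a) A `&` _ => bY bX sXY.
  have K0corner a' b' : ncard (bd (side o a' A `&` side o b' B)) <= k ->
      ~ U (bd (side o a' A `&` side o b' B)) -> K0 (side o a' A `&` side o b' B).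
    move=> le nU; split; first by split=> // x [/side_sub-/(_ AH)].
    move=> D FD; apply/nested_sym; apply: nested_corner; last exact: opp'.
      by apply: nested_side; [exact: FH | apply/nested_sym/nA].
    by apply: nested_side; [exact: FH | apply/nested_sym/nB].
  have K0X : K0 X by apply: K0corner => //; rewrite -/X; lia.
  have K0Y : K0 Y by apply: K0corner => //; rewrite -/Y; lia.
  have := minA _ K0X; have := minA _ K0Y.
  (* A candidate crossing one of the corners [X] and [Y] crosses [A] or [B], and
     both if it crosses both corners; but [A] itself crosses [B] and neither
     corner. *)
  suff : ncard (cr K0 X) + ncard (cr K0 Y) < ncard (cr K0 A) + ncard (cr K0 B) by lia.
  have cr_of a' b' D : cr K0 (side o a' A `&` side o b' B) D -> cr K0 A D \/ cr K0 B D.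
    move=> [K0D nn']; apply: contrapT => N; apply: nn'.
    have DH := K0H _ K0D.
    have nAD : nested o A D by apply: contrapT => ?; apply: N; left.
    have nBD : nested o B D by apply: contrapT => ?; apply: N; right.
    apply/nested_sym; apply: nested_corner; last exact: opp'.
      by apply: nested_side => //; exact: nested_sym.
    by apply: nested_side => //; exact: nested_sym.
  have notboth D A' B' a' b' : A' `<=` component o -> B' `<=` component o ->
      D `<=` component o -> nested o A' D -> nested o D (side o a' A' `&` side o b' B') \/
      nested o D (side o (~~ a') A' `&` side o (~~ b') B').
    move=> A'H B'H DH /nested_sym /(nested_side a' DH) /(nested_opposite (side o b' B') DH).
    by rewrite !side_neg.
  apply: (@ncard_add_lt _ _ _ _ _ A).
  - exact: fin_cr.
  - exact: fin_cr.
  - by move=> D [|] /cr_of.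
  - move=> D [[K0D nXD] [_ nYD]]; have DH := K0H _ K0D; split; split=> // nD.
      have [H|H] := @notboth D A B a b AH BH DH nD; [apply: nXD|apply: nYD];
        exact: nested_sym.
    have [] := @notboth D B A b a BH AH DH nD; rewrite setIC => H;
      [apply: nXD|apply: nYD]; exact: nested_sym.
  - by right; split=> // /nested_sym.
  - have nAc a' b' : nested o (side o a' A `&` side o b' B) A.
      apply/(nested_sideE a') => //; first by move=> x [/side_sub-/(_ AH)].
      by apply: Or42 => x [].
    by move=> [[_ ]|[_]]; apply; exact: nAc.
exists A; split.
- by move=> C; rewrite inE => /orP[/eqP ->|/ga //]; split=> //; exact: Kindec.
- have aux f C : stab o f -> translates o s C -> nested o (f @` A) C.
    by move=> sf tC; have [_ ] := K0image _ _ sf K0A; apply.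
  move=> C D [C' [f [+ sf ->]]] [D' [g [+ sg ->]]]; rewrite !inE.
  move=> /orP[/eqP ->|Cs] /orP[/eqP ->|Ds].
  + have [f' [sf' ff' f'f]] := stab_inv sf.
    rewrite -(image_cancel (g @` A) f'f); apply: nested_image => //.
    rewrite image_comp; apply: self; exact: stab_comp.
  + by apply: aux => //; exists D', g.
  + by apply/nested_sym/aux => //; exists C', f.
  + by apply: gb; [exists C', f | exists D', g].
- split=> // B f Bs fAut E; apply: nUA; rewrite -E -act_bd //; apply: UA => //.
  apply: span_gen; exists id, (bd B); split; first exact: Aut_id.
    exact: map_f.
  by rewrite act_bd ?image_id //; exact: Aut_id.
- move=> F cF lF; have := gd F cF lF; apply: span_mono.
  move=> _ [f [C [fAut Cs ->]]]; exists f, C; split=> //=.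
  by rewrite inE; apply/orP; right.
Qed.

End Final.

Theorem theorem1p1 (G : graph) (G_trans : transitive_graph G) :
  finitely_generated (@cycle_space G) -> finitely_generated (@cut_space G).
Proof.
move=> fg; have cutM := cut_space_module G.
have gen_cut (s : seq (edgeset G)) : [set` s] `<=` @cut_space G ->
    span (Aut_orbits [set` s]) `<=` @cut_space G.
  have [c0 cD cA] := cutM => sc; apply: span_min => // _ [f [C [fA Cs ->]]].
  by apply: cA => //; exact: sc.
have [[o _]|empty] := pselect (exists o : G, True); last first.
  (* In the graph without vertices the only cut is empty. *)
  exists [::]; split=> //; apply/seteqP; split; first exact: gen_cut.
  move=> F /cut_spaceP[A _ ->]; rewrite (_ : bd A = set0); first exact: span0.
  by apply/seteqP; split=> // e /bdP[x _]; case: empty; exists x.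
have [R RP] := finitely_many_branchings G_trans fg.
have bound k s : nested_system o k s -> size s <= size R by apply: nested_system_size => k' E A; apply: RP.
have good0 : nested_system o 0 (@nil (set G)).
  by split=> // A B [? [? []]].
(* A largest system can never be enlarged, hence it generates the cuts of every
   size. *)
have [[k s] gs smax] := @argmin_nat _ [set ks : nat * seq (set G) | nested_system o ks.1 ks.2]
  (fun ks => size R - size ks.2) (ex_intro _ (0, [::]) good0).
have step k' : nested_system o k' s -> nested_system o k'.+1 s.
  move=> gk; have [ga gb gc gd] := gk; split=> //.
    by move=> A /ga[AH iA le]; split=> //; exact: leqW.
  move=> F cF; rewrite ltnS => lF; apply: contrapT => nF.
  have [|A gA] := nested_system_extend G_trans gk; first by exists F.
  by have := smax (k', A :: s) gA; have := bound _ _ gA; rewrite /=; lia.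
have all_good j : nested_system o (k + j) s.
  by elim: j => [|j IH]; rewrite ?addn0 // addnS; exact: step.
have [ga _ _ _] := gs.
have sc : [set` map (@bd G) s] `<=` @cut_space G.
  by move=> _ /mapP[A /ga[_ [fA _] _] ->]; exact: cut_space_bd.
exists (map (@bd G) s); split=> //; apply/seteqP; split; first exact: gen_cut.
move=> F cF; have [_ _ _ gd] := all_good (ncard F).+1.
by apply: gd => //; rewrite addnS ltnS leq_addl.
Qed.
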